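(* Let $f$ be in $S$ with $\lvert f(0) \rvert < 1$. If $0 \leq r \leq \max(\lvert f(0) \rvert, 1/3)$, then \[Mf(r) \leq M\varphi(r),\] where $\varphi(z) = \frac{w-z}{1-\overline{w}z}$ for $w = f(0)$.
   Context: Let $\mathbb{D}$ be the open unit disc in the complex plane. For an analytic function $f(z) = \sum_{k \geq 0} a_k z^k$ in $\mathbb{D}$, its majorant function is $Mf(z) = \sum_{k=0}^\infty \lvert a_k \rvert z^k$. The Schur class $S$ is the set of analytic functions $f$ in $\mathbb{D}$ that satisfy $\lvert f(z) \rvert \leq 1$ for every $z$ in $\mathbb{D}$. *)

(* Defs.v *)
From Stdlib Require Export Reals ClassicalEpsilon.
From Coquelicot Require Export Coquelicot.
Open Scope R_scope.

Definition unit_disc (z : C) : Prop := Cmod z < 1.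

(* Values of [f] outside the disc are irrelevant: the neighbourhood given by
   [locally z0] may always be shrunk to lie inside the (open) disc. *)
Definition analytic_at (f : C -> C) (z0 : C) : Prop :=
  exists c : nat -> C,
    locally z0 (fun z : C => is_pseries c (z - z0)%C (f z)).

Definition analytic_in_disc (f : C -> C) : Prop :=
  forall z0 : C, unit_disc z0 -> analytic_at f z0.

Definition schur_class (f : C -> C) : Prop :=
  analytic_in_disc f /\ forall z : C, unit_disc z -> Cmod (f z) <= 1.

Definition has_expansion (f : C -> C) (a : nat -> C) : Prop :=
  forall z : C, unit_disc z -> is_pseries a z (f z).

(* The sequence [a] with f(z) = sum_k a_k z^k for all z in the disc. Every
   function analytic in the disc has exactly one such sequence; the value is
   unspecified for other functions. *)
Definition coeffs (f : C -> C) : nat -> C :=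
  epsilon (inhabits (fun _ : nat => RtoC 0)) (has_expansion f).

(* Mf(r) = sum_k |a_k| r^k at a real point r. For [f] analytic in the disc the
   series converges whenever |r| < 1, so that [PSeries] is its actual sum. *)
Definition majorant (f : C -> C) (r : R) : R :=
  PSeries (fun k : nat => Cmod (coeffs f k)) r.

Definition disc_automorphism (w z : C) : C :=
  ((w - z) / (1 - Cconj w * z))%C.

(* Main.v *)
Require Import Defs.
From Stdlib Require Import Arith Lra Lia Psatz.

(** Let w = f(0) and a = |w| < 1. The Schur step (w - f) / (1 - conj w f) = z g
    produces g, analytic in the disc and bounded by 1, with
      w - f = z g (1 - conj w f).
    The Taylor coefficients c of g act on formal power series, truncated to any
    order, as a contraction of the l^2 norm ([bounded_contraction]); this yields
    |c_k| <= 1 - |c_0|^2 for k >= 1, hence Mg(r) <= 1 for r <= 1/3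
    ([bohr_third]). Put T(r) = Mf(r) - a. If r <= 1/3, the identity above gives
    T <= r ((1 - a^2) + a T). If r <= a, the contraction property applied to the
    identity, with weights (r/a)^k, and the Cauchy-Schwarz inequality lead to the
    same conclusion T <= r (1 - a^2) / (1 - a r) ([majorant_tail_bound]). The
    right-hand side plus a is the majorant of the automorphism, whose
    coefficients are explicit ([majorant_automorphism]).

    The complex analysis rests on the maximum principle alone. Analyticity is
    used only through asymptotic expansions of all orders at every point
    ([expands_at]), a property stable under quotients. Replacing |g|^2 by
    |g|^2 + eps |z|^2 and averaging over four neighbours of a point excludes
    interior maxima ([maximum_principle]). Schwarz's lemma and the Schur
    algorithm follow, and then the contraction property, by induction on the
    order. In particular the coefficients have modulus at most 1, so that the
    maximum principle applied to Taylor remainders shows that the expansion at 0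
    converges to f in the whole disc ([bounded_expansion]). *)

(** * Formal power series *)

Open Scope C_scope.

Definition tail (a : nat -> C) : nat -> C := fun k => a (S k).

Definition shift (a : nat -> C) : nat -> C :=
  fun k => match k with O => RtoC 0 | S m => a m end.

(** The coefficients of p + q f, when [a] lists those of f. *)
Definition affine (p q : C) (a : nat -> C) : nat -> C :=
  fun k => match k with O => p + q * a O | S m => q * a (S m) end.

(** The Cauchy product. With f = f(0) + z f_1 for the left factor, the recursion
    f g = f(0) g + z (f_1 g) makes associativity and commutativity plain
    inductions, without any exchange of sums. *)
Fixpoint conv (a b : nat -> C) (n : nat) : C :=
  match n with
  | O => a O * b O
  | S m => a O * b (S m) + conv (tail a) b m
  end.

(** Long division of formal power series, lowest coefficients first. *)
Fixpoint fdiv (a b : nat -> C) (n : nat) : C :=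
  match n with
  | O => a O / b O
  | S m => fdiv (fun k => a (S k) - a O / b O * b (S k)) b m
  end.

Lemma conv_ext (a a' b b' : nat -> C) (n : nat) :
  (forall k, a k = a' k) -> (forall k, b k = b' k) ->
  conv a b n = conv a' b' n.
Proof.
revert a a'; induction n as [|n IH]; intros a a' Ha Hb; simpl.
- now rewrite Ha, Hb.
- rewrite Ha, Hb, (IH (tail a) (tail a')); auto.
  intros k; apply Ha.
Qed.

Lemma conv_fdiv (a b : nat -> C) (n : nat) :
  b O <> 0 -> conv (fdiv a b) b n = a n.
Proof.
intros Hb; revert a; induction n as [|n IH]; intros a; simpl.
- now field.
- change (tail (fdiv a b))
    with (fdiv (fun k => a (S k) - a O / b O * b (S k)) b).
  rewrite IH. ring.
Qed.

Lemma conv_plus_l (a b p : nat -> C) (n : nat) :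
  conv (fun k => a k + b k) p n = conv a p n + conv b p n.
Proof.
revert a b; induction n as [|n IH]; intros a b; simpl.
- ring.
- change (tail (fun k => a k + b k)) with (fun k => tail a k + tail b k).
  rewrite IH. ring.
Qed.

Lemma conv_scal_l (l : C) (a p : nat -> C) (n : nat) :
  conv (fun k => l * a k) p n = l * conv a p n.
Proof.
revert a; induction n as [|n IH]; intros a; simpl.
- ring.
- change (tail (fun k => l * a k)) with (fun k => l * tail a k).
  rewrite IH. ring.
Qed.

Lemma conv_last (a b : nat -> C) (n : nat) :
  conv a b (S n) = conv a (tail b) n + a (S n) * b O.
Proof.
revert a; induction n as [|n IH]; intros a.
- simpl; unfold tail; ring.
- change (conv a b (S (S n)))
    with (a O * b (S (S n)) + conv (tail a) b (S n)).
  rewrite IH. simpl. unfold tail; ring.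
Qed.

Lemma conv_comm (a b : nat -> C) (n : nat) : conv a b n = conv b a n.
Proof.
revert a b; induction n as [|n IH]; intros a b.
- simpl; ring.
- rewrite conv_last, IH. simpl. ring.
Qed.

Lemma conv_assoc (a b p : nat -> C) (n : nat) :
  conv a (conv b p) n = conv (conv a b) p n.
Proof.
revert a; induction n as [|n IH]; intros a; simpl.
- ring.
- rewrite IH.
  rewrite (conv_ext (tail (conv a b))
             (fun k => a O * tail b k + conv (tail a) b k) p p n);
    [|intros; reflexivity|auto].
  rewrite (conv_plus_l (fun k => a O * tail b k)), conv_scal_l. ring.
Qed.

Lemma conv_affine_l (x y : C) (a p : nat -> C) (n : nat) :
  conv (affine x y a) p n = x * p n + y * conv a p n.
Proof.
destruct n as [|n]; simpl; [ring|].
change (tail (affine x y a)) with (fun k => y * tail a k).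
rewrite conv_scal_l. ring.
Qed.

Lemma conv_affine_r (x y : C) (a p : nat -> C) (n : nat) :
  conv p (affine x y a) n = x * p n + y * conv p a n.
Proof.
now rewrite conv_comm, conv_affine_l, (conv_comm a p).
Qed.

Lemma conv_shift_l (a p : nat -> C) (n : nat) :
  conv (shift a) p n = shift (conv a p) n.
Proof.
destruct n as [|n]; simpl; [ring|].
change (tail (shift a)) with a. ring.
Qed.

Close Scope C_scope.

(** * Toeplitz contractions *)

Definition energy (p : nat -> C) (n : nat) : R :=
  sum_f_R0 (fun k => Cmod (p k) ^ 2) n.

(** The lower triangular Toeplitz matrix of [a], cut to size n + 1, is a
    contraction. This is the form in which the Schur class is used: it mentions
    Taylor coefficients only. *)
Definition contraction (a : nat -> C) (n : nat) : Prop :=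
  forall p : nat -> C, energy (conv a p) n <= energy p n.

(** For v = f u this compares the numerator and the denominator of
    (w - f) / (1 - conj w f), so the Moebius map preserves contractions. *)
Lemma moebius_energy (w u v : C) :
  Cmod (u - Cconj w * v) ^ 2 - Cmod (w * u - v) ^ 2
  = (1 - Cmod w ^ 2) * (Cmod u ^ 2 - Cmod v ^ 2).
Proof.
rewrite !Cmod2_alt.
destruct w, u, v; unfold Re, Im, Cminus, Cplus, Cmult, Copp, Cconj; simpl; ring.
Qed.

Lemma Cconj_mult_self (w : C) : (Cconj w * w = RtoC (Cmod w ^ 2))%C.
Proof.
rewrite Cmult_comm, <- Cmod2_conj. now rewrite RtoC_pow.
Qed.

(** Inverting the relation z g = (w - f) / (1 - conj w f) gives
    f = (w - z g) / (1 - conj w z g). With u = p / (1 - conj w z g) one has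
    p = u - conj w v and f p = w u - v, where v = z g u; the contraction
    property of g for size n bounds the energy of v, whose first coefficient
    vanishes, and [moebius_energy] carries the bound to p and f p. *)
Lemma schur_step_contraction (w : C) (a c : nat -> C) (n : nat) :
  Cmod w < 1 ->
  (forall k, conv (shift c) (affine 1 (- Cconj w) a) k
             = affine w (-1) a k)%C ->
  contraction c n -> contraction a (S n).
Proof.
intros Hw Hrel Hc p.
assert (Hs : forall k : nat,
  (conv a (affine 1 (- Cconj w) (shift c)) k
   = affine w (-1) (shift c) k)%C).
{ intros k. generalize (Hrel k).
  rewrite !conv_affine_r, (conv_comm (shift c)). intros H.
  destruct k as [|k].
  - simpl in *. revert H.
    set (x := (a O)); intros H.
    transitivity ((1 * 0 + - Cconj w * (x * 0)) + x)%C; [ring|].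
    rewrite H. ring.
  - simpl in *. set (x := a (S k)) in *.
    transitivity ((1 * c k
      + - Cconj w * (a O * c k + conv (tail a) (shift c) k)) + x - c k)%C; [ring|].
    rewrite H. ring. }
set (u := fdiv p (affine 1 (- Cconj w) (shift c))).
assert (Hu : forall k, conv (affine 1 (- Cconj w) (shift c)) u k = p k).
{ intros k. rewrite conv_comm. apply conv_fdiv.
  simpl. replace (1 + - Cconj w * 0)%C with (RtoC 1) by ring.
  apply C1_nz. }
assert (Hap : forall k,
  conv a p k = conv (affine w (-1) (shift c)) u k).
{ intros k.
  rewrite (conv_ext a a p (conv (affine 1 (- Cconj w) (shift c)) u) k);
    [|auto|now intros; rewrite Hu].
  rewrite conv_assoc. apply conv_ext; auto. }
set (v := conv (shift c) u).
assert (Hpw : forall k, Cmod (p k) ^ 2 - Cmod (conv a p k) ^ 2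
   = (1 - Cmod w ^ 2) * (Cmod (u k) ^ 2 - Cmod (v k) ^ 2)).
{ intros k. rewrite <- moebius_energy, Hap, <- Hu, !conv_affine_l.
  fold v. do 3 f_equal; ring. }
assert (Hv : energy v (S n) <= energy u (S n)).
{ unfold energy at 1. rewrite decomp_sum by lia.
  unfold v at 1; rewrite conv_shift_l. simpl shift. rewrite Cmod_0.
  rewrite (sum_eq (fun i => Cmod (v (S i)) ^ 2)
                  (fun i => Cmod (conv c u i) ^ 2));
    [|intros i _; unfold v; now rewrite conv_shift_l].
  generalize (Hc u). unfold energy. simpl Nat.pred. rewrite tech5.
  generalize (pow2_ge_0 (Cmod (u (S n)))). lra. }
assert (He : energy p (S n) - energy (conv a p) (S n)
  = (1 - Cmod w ^ 2) * (energy u (S n) - energy v (S n))).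
{ unfold energy. rewrite <- !minus_sum, scal_sum.
  apply sum_eq. intros i _. rewrite Hpw. ring. }
assert (0 <= 1 - Cmod w ^ 2) by (generalize (Cmod_ge_0 w); nra).
nra.
Qed.

(** Reduces the contraction property of f to that of l f with l < 1, for
    which the Schur step is always available. *)
Lemma contraction_scale_limit (a : nat -> C) (n : nat) :
  (forall l : R, 0 < l < 1 -> contraction (fun k => RtoC l * a k)%C n) ->
  contraction a n.
Proof.
intros H p. apply Rnot_lt_le. intros Hlt.
assert (Hp : 0 <= energy p n).
{ apply cond_pos_sum. intros; apply pow2_ge_0. }
set (E := energy (conv a p) n) in *. set (P := energy p n) in *.
assert (Hl : forall l, 0 < l < 1 -> l ^ 2 * E <= P).
{ intros l Hl. apply Rle_trans with (2 := H l Hl p).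
  apply Req_le. unfold E, energy. rewrite scal_sum. apply sum_eq.
  intros i _. rewrite conv_scal_l, Cmod_mult, Cmod_R, Rabs_pos_eq; [ring|lra]. }
assert (HE : 0 < E) by lra.
(* (1 - e)^2 >= 1 - 2e, with e chosen so that (1 - 2e) E > P *)
set (e := (E - P) / (4 * E)).
assert (He : e * (4 * E) = E - P) by (unfold e; field; lra).
assert (0 < e) by (unfold e; apply Rdiv_lt_0_compat; lra).
assert (e < 1) by nra.
assert (Hle := Hl (1 - e) ltac:(lra)). nra.
Qed.

(** Test on the constant series 1. *)
Lemma contraction_coef (a : nat -> C) (n k : nat) :
  (k <= n)%nat -> contraction a n -> Cmod (a k) <= 1.
Proof.
intros Hk Ha.
set (d := fun k : nat => match k with O => RtoC 1 | _ => RtoC 0 end).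
assert (Hd : forall i, conv a d i = a i).
{ intros i. rewrite conv_comm.
  rewrite (conv_ext d (affine 1 0 d) a a); auto.
  - rewrite conv_affine_l. ring.
  - intros [|j]; simpl; ring. }
generalize (Ha d). unfold energy.
assert (Hd1 : sum_f_R0 (fun k => Cmod (d k) ^ 2) n = 1).
{ clear. induction n as [|n IH]; simpl.
  - rewrite Cmod_1; ring.
  - simpl in IH. rewrite IH, Cmod_0. ring. }
rewrite Hd1, (sum_eq _ (fun k => Cmod (a k) ^ 2))
  by (intros; now rewrite Hd).
intros H.
assert (Cmod (a k) ^ 2 <= sum_f_R0 (fun k => Cmod (a k) ^ 2) n).
{ clear -Hk. induction n as [|n IH].
  - replace k with O by lia. simpl; lra.
  - rewrite tech5. destruct (Nat.eq_dec k (S n)) as [->|].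
    + assert (0 <= sum_f_R0 (fun k => Cmod (a k) ^ 2) n)
        by (apply cond_pos_sum; intros; apply pow2_ge_0). lra.
    + generalize (pow2_ge_0 (Cmod (a (S n)))).
      specialize (IH ltac:(lia)). lra. }
generalize (Cmod_ge_0 (a k)). nra.
Qed.

Lemma conv_low_zero_l (q c : nat -> C) (m : nat) :
  (forall i, (i < m)%nat -> q i = RtoC 0) -> conv q c m = (q m * c O)%C.
Proof.
revert q; induction m as [|m IH]; intros q Hq; simpl.
- reflexivity.
- rewrite Hq by lia. rewrite IH.
  + unfold tail. ring.
  + intros i Hi. apply Hq. lia.
Qed.

(** Test on 1 + y z^k. With y = conj(c_0) c_k t and b = |c_0| < 1, the
    value t = 1 / (1 - b^2) is the optimal one; for b = 1, t = 0 suffices. *)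
Lemma contraction_coef_gap (c : nat -> C) (k : nat) :
  contraction c (S k) -> Cmod (c (S k)) <= 1 - Cmod (c O) ^ 2.
Proof.
intros Hc.
assert (Hb : Cmod (c O) <= 1) by (apply contraction_coef with (2 := Hc); lia).
assert (Hb0 := Cmod_ge_0 (c O)). assert (Hx0 := Cmod_ge_0 (c (S k))).
set (b := Cmod (c O)) in *. set (x := Cmod (c (S k))) in *.
assert (Ht : forall t : R, 0 <= t ->
  b ^ 2 + (x * (1 + b ^ 2 * t)) ^ 2 <= 1 + (b * x * t) ^ 2).
{ intros t Ht.
  set (y := (Cconj (c O) * c (S k) * RtoC t)%C).
  set (p := fun i : nat => match i with O => RtoC 1
                           | S j => if Nat.eqb j k then y else RtoC 0 end).
  assert (Hy : Cmod y = b * x * t).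
  { unfold y. rewrite !Cmod_mult, Cmod_conj, Cmod_R, Rabs_pos_eq; auto. }
  assert (H0 : Cmod (conv c p 0) = b).
  { simpl. rewrite Cmult_1_r. reflexivity. }
  assert (H1 : Cmod (conv c p (S k)) = x * (1 + b ^ 2 * t)).
  { rewrite conv_comm. simpl conv. rewrite conv_low_zero_l.
    - change (tail p k) with (if Nat.eqb k k then y else RtoC 0).
      rewrite Nat.eqb_refl. change (p O) with (RtoC 1).
      replace (1 * c (S k) + y * c O)%C
        with (c (S k) * RtoC (1 + b ^ 2 * t))%C.
      + rewrite Cmod_mult, Cmod_R, Rabs_pos_eq; auto. nra.
      + unfold y, b. rewrite RtoC_plus, RtoC_mult, <- Cconj_mult_self. ring.
    - intros i Hi. unfold tail, p.
      destruct (Nat.eqb_spec i k); [lia|reflexivity]. }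
  assert (Hp : energy p (S k) = 1 + (b * x * t) ^ 2).
  { unfold energy. rewrite decomp_sum by lia. simpl Nat.pred.
    change (p O) with (RtoC 1). rewrite Cmod_1.
    f_equal; [ring|]. rewrite <- Hy.
    clear. unfold p. clear p.
    assert (Hz : forall m, (m <= k)%nat ->
      sum_f_R0 (fun i => Cmod (if Nat.eqb i k then y else 0) ^ 2) m
      = if Nat.eqb m k then Cmod y ^ 2 else 0).
    { induction m as [|m IH]; intros Hm; [unfold sum_f_R0|rewrite tech5].
      - destruct (Nat.eqb 0 k); [auto|]. rewrite Cmod_0; ring.
      - rewrite IH by lia.
        replace (Nat.eqb m k) with false by (symmetry; apply Nat.eqb_neq; lia).
        destruct (Nat.eqb (S m) k); [ring|rewrite Cmod_0; ring]. }
    rewrite Hz by lia. now rewrite Nat.eqb_refl. }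
  rewrite <- Hp, <- H1, <- H0. apply Rle_trans with (2 := Hc p).
  unfold energy. rewrite decomp_sum by lia. simpl Nat.pred.
  apply Rplus_le_compat_l. destruct k as [|k]; [simpl; lra|].
  rewrite tech5. generalize (cond_pos_sum (fun i => Cmod (conv c p (S i)) ^ 2) k
    (fun i => pow2_ge_0 _)). lra. }
destruct (Rlt_le_dec b 1) as [Hlt|Hge].
- assert (Hd : 0 < 1 - b ^ 2) by nra.
  assert (H := Ht (/ (1 - b ^ 2)) ltac:(left; apply Rinv_0_lt_compat; lra)).
  set (t := / (1 - b ^ 2)) in *.
  assert (Htd : t * (1 - b ^ 2) = 1) by (unfold t; field; lra).
  replace (1 + b ^ 2 * t) with t in H by lra.
  assert (x ^ 2 * t <= 1 - b ^ 2).
  { replace (x ^ 2 * t) with (x ^ 2 * t * (t * (1 - b ^ 2))) by (rewrite Htd; ring).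
    lra. }
  assert (x ^ 2 <= (1 - b ^ 2) ^ 2).
  { replace (x ^ 2) with (x ^ 2 * t * (1 - b ^ 2))
      by (rewrite Rmult_assoc, Htd; ring). nra. }
  apply Rnot_lt_le. intros Hn. nra.
- assert (H := Ht 0 ltac:(lra)). nra.
Qed.

(** * Asymptotic expansions *)

(** The sum of the first n terms at h, in Horner form, to match the shape of
    [conv]. *)
Fixpoint psum (n : nat) (a : nat -> C) (h : C) : C :=
  match n with
  | O => RtoC 0
  | S m => (a O + h * psum m (tail a) h)%C
  end.

Lemma psum_ext (n : nat) (a b : nat -> C) (h : C) :
  (forall k, a k = b k) -> psum n a h = psum n b h.
Proof.
revert a b; induction n as [|n IH]; intros a b Hab; simpl; auto.
rewrite Hab, (IH (tail a) (tail b)); auto. intros; apply Hab.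
Qed.

Lemma psum_last (n : nat) (a : nat -> C) (h : C) :
  psum (S n) a h = (psum n a h + a n * h ^ n)%C.
Proof.
revert a; induction n as [|n IH]; intros a.
- simpl; ring.
- change (psum (S (S n)) a h) with (a O + h * psum (S n) (tail a) h)%C.
  rewrite IH. simpl. unfold tail. ring.
Qed.

Lemma psum_lin (n : nat) (l : C) (a b : nat -> C) (h : C) :
  psum n (fun k => l * a k + b k)%C h = (l * psum n a h + psum n b h)%C.
Proof.
revert a b; induction n as [|n IH]; intros a b; simpl; [ring|].
change (tail (fun k => l * a k + b k)%C)
  with (fun k => l * tail a k + tail b k)%C.
rewrite IH. ring.
Qed.

Lemma psum_zero (n : nat) (h : C) : psum n (fun _ => RtoC 0) h = RtoC 0.
Proof.
induction n as [|n IH]; simpl; auto.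
change (tail (fun _ => RtoC 0)) with (fun _ : nat => RtoC 0).
rewrite IH. ring.
Qed.

Lemma psum_add (n m : nat) (a : nat -> C) (h : C) :
  psum (n + m) a h = (psum n a h + h ^ n * psum m (fun k => a (n + k)%nat) h)%C.
Proof.
revert a; induction n as [|n IH]; intros a.
- change (psum m a h = 0 + 1 * psum m a h)%C. ring.
- change (psum (S n + m) a h) with (a O + h * psum (n + m) (tail a) h)%C.
  rewrite IH. change (psum (S n) a h) with (a O + h * psum n (tail a) h)%C.
  change (fun k => a (S n + k)%nat) with (fun k => tail a (n + k)%nat).
  change (h ^ S n)%C with (h * h ^ n)%C. ring.
Qed.

Definition bigO (n : nat) (F : C -> C) : Prop :=
  exists K d : R, 0 <= K /\ 0 < d /\
    forall h : C, Cmod h < d -> Cmod (F h) <= K * Cmod h ^ n.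

Lemma bigO_near (n : nat) (F G : C -> C) (r : R) : 0 < r ->
  (forall h, Cmod h < r -> F h = G h) -> bigO n F -> bigO n G.
Proof.
intros Hr HFG (K & d & HK & Hd & H).
exists K, (Rmin d r). repeat split; auto.
- now apply Rmin_pos.
- intros h Hh. rewrite <- HFG.
  + apply H. eapply Rlt_le_trans; [exact Hh|apply Rmin_l].
  + eapply Rlt_le_trans; [exact Hh|apply Rmin_r].
Qed.

Lemma bigO_ext (n : nat) (F G : C -> C) :
  (forall h, F h = G h) -> bigO n F -> bigO n G.
Proof. intros H. apply bigO_near with 1; auto. lra. Qed.

Lemma bigO_plus (n : nat) (F G : C -> C) :
  bigO n F -> bigO n G -> bigO n (fun h => F h + G h)%C.
Proof.
intros (K & d & HK & Hd & H) (K' & d' & HK' & Hd' & H').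
exists (K + K'), (Rmin d d'). repeat split; [lra|now apply Rmin_pos|].
intros h Hh.
assert (Cmod h < d) by (eapply Rlt_le_trans; [exact Hh|apply Rmin_l]).
assert (Cmod h < d') by (eapply Rlt_le_trans; [exact Hh|apply Rmin_r]).
eapply Rle_trans; [apply Cmod_triangle|].
rewrite Rmult_plus_distr_r. apply Rplus_le_compat; auto.
Qed.

Lemma bigO_mult (n m : nat) (F G : C -> C) :
  bigO n F -> bigO m G -> bigO (n + m) (fun h => F h * G h)%C.
Proof.
intros (K & d & HK & Hd & H) (K' & d' & HK' & Hd' & H').
exists (K * K'), (Rmin d d'). repeat split; [nra|now apply Rmin_pos|].
intros h Hh.
assert (Cmod h < d) by (eapply Rlt_le_trans; [exact Hh|apply Rmin_l]).
assert (Cmod h < d') by (eapply Rlt_le_trans; [exact Hh|apply Rmin_r]).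
rewrite Cmod_mult, pow_add.
replace (K * K' * (Cmod h ^ n * Cmod h ^ m))
  with ((K * Cmod h ^ n) * (K' * Cmod h ^ m)) by ring.
apply Rmult_le_compat; auto using Cmod_ge_0.
Qed.

Lemma bigO_const (c : C) : bigO 0 (fun _ => c).
Proof.
exists (Cmod c), 1. repeat split; [apply Cmod_ge_0|lra|].
intros h _. simpl. lra.
Qed.

Lemma bigO_pow (n : nat) : bigO n (fun h => h ^ n)%C.
Proof.
exists 1, 1. repeat split; try lra. intros h _. rewrite Cmod_pow. lra.
Qed.

Lemma bigO_scal (n : nat) (c : C) (F : C -> C) :
  bigO n F -> bigO n (fun h => c * F h)%C.
Proof. intros H. apply (bigO_mult 0 n); auto. apply bigO_const. Qed.

Lemma bigO_id_mult (n : nat) (F : C -> C) :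
  bigO n F -> bigO (S n) (fun h => h * F h)%C.
Proof.
intros H. apply (bigO_mult 1 n); auto.
apply (bigO_ext 1 (fun h => h ^ 1)%C); [intros h; simpl; ring|apply bigO_pow].
Qed.

Lemma bigO_weaken (n : nat) (F : C -> C) : bigO (S n) F -> bigO n F.
Proof.
intros (K & d & HK & Hd & H). exists K, (Rmin d 1).
repeat split; auto; [apply Rmin_pos; lra|]. intros h Hh.
assert (Cmod h < d) by (eapply Rlt_le_trans; [exact Hh|apply Rmin_l]).
assert (Cmod h < 1) by (eapply Rlt_le_trans; [exact Hh|apply Rmin_r]).
apply Rle_trans with (1 := H h H0). apply Rmult_le_compat_l; auto.
simpl. generalize (pow_le _ n (Cmod_ge_0 h)) (Cmod_ge_0 h). nra.
Qed.

Lemma psum_bigO (n : nat) (a : nat -> C) : bigO 0 (psum n a).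
Proof.
revert a; induction n as [|n IH]; intros a; simpl.
- apply bigO_const.
- apply (bigO_plus 0 (fun _ => a O)); [apply bigO_const|].
  apply bigO_weaken, bigO_id_mult, IH.
Qed.

(** The difference collects only products of terms of total degree at least
    n. *)
Lemma psum_conv (n : nat) (a b : nat -> C) :
  bigO n (fun h => psum n a h * psum n b h - psum n (conv a b) h)%C.
Proof.
revert a; induction n as [|n IH]; intros a.
- apply (bigO_ext 0 (fun _ => RtoC 0)); [intros; simpl; ring|apply bigO_const].
- apply (bigO_ext (S n) (fun h =>
    h * ((psum n (tail a) h * psum n b h - psum n (conv (tail a) b) h)
         + psum n (tail a) h * (b n * h ^ n))))%C.
  + intros h.
    change (psum (S n) a h) with (a O + h * psum n (tail a) h)%C.
    change (psum (S n) (conv a b) h)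
      with (a O * b O + h * psum n (tail (conv a b)) h)%C.
    rewrite (psum_ext n (tail (conv a b))
      (fun k => a O * tail b k + conv (tail a) b k)%C) by reflexivity.
    rewrite psum_lin.
    transitivity (a O * (b O + h * psum n (tail b) h)
      + h * psum n (tail a) h * (psum n b h + b n * h ^ n)
      - (a O * b O
         + h * (a O * psum n (tail b) h + psum n (conv (tail a) b) h)))%C; [ring|].
    rewrite <- psum_last. simpl. ring.
  + apply bigO_id_mult, bigO_plus; auto.
    apply (bigO_mult 0 n); [apply psum_bigO|].
    apply bigO_scal, bigO_pow.
Qed.

(** An asymptotic expansion of all orders at z0. Unlike convergence of a power
    series, this property passes to quotients with no estimate on the
    coefficients. *)
Definition expands_at (f : C -> C) (z0 : C) (a : nat -> C) : Prop :=
  forall n, bigO n (fun h => (f (z0 + h) - psum n a h)%C).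

(** Local information of this kind carries the maximum principle, and
    convergence in the whole disc follows from it in [bounded_expansion]. *)
Definition smooth_in_disc (f : C -> C) : Prop :=
  forall z0, unit_disc z0 -> exists a, expands_at f z0 a.

Lemma expands_at_value (f : C -> C) (z0 : C) (a : nat -> C) :
  expands_at f z0 a -> f z0 = a O.
Proof.
intros H. destruct (H 1%nat) as (K & d & _ & Hd & H1).
specialize (H1 (RtoC 0)). rewrite Cmod_0 in H1. specialize (H1 Hd).
simpl in H1. rewrite Cplus_0_r in H1.
assert (E : (f z0 - (a O + 0 * 0) = 0)%C).
{ apply Cmod_eq_0. generalize (Cmod_ge_0 (f z0 - (a O + 0 * 0))). lra. }
transitivity (f z0 - (a O + 0 * 0) + a O)%C; [ring|]. rewrite E. ring.
Qed.

Lemma expands_at_near (f g : C -> C) (z0 : C) (a : nat -> C) (r : R) :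
  0 < r -> (forall h, Cmod h < r -> f (z0 + h)%C = g (z0 + h)%C) ->
  expands_at f z0 a -> expands_at g z0 a.
Proof.
intros Hr Hfg Hf n. apply bigO_near with (3 := Hf n) (r := r); auto.
intros h Hh; simpl. now rewrite Hfg.
Qed.

Lemma expands_at_coef_ext (f : C -> C) (z0 : C) (a b : nat -> C) :
  (forall k, a k = b k) -> expands_at f z0 a -> expands_at f z0 b.
Proof.
intros Hab Hf n. apply bigO_ext with (2 := Hf n).
intros h; simpl. now rewrite (psum_ext n a b).
Qed.

Lemma expands_at_affine (p q : C) (f : C -> C) (z0 : C) (a : nat -> C) :
  expands_at f z0 a ->
  expands_at (fun z => p + q * f z)%C z0 (affine p q a).
Proof.
intros Hf [|n].
- apply (bigO_ext 0 (fun h => p + q * (f (z0 + h) - psum 0 a h)))%C;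
    [intros h; simpl; ring|].
  apply (bigO_plus 0 (fun _ => p)); [apply bigO_const|].
  apply bigO_scal, Hf.
- apply (bigO_ext (S n) (fun h => q * (f (z0 + h) - psum (S n) a h)))%C.
  + intros h. simpl.
    change (tail (affine p q a)) with (fun k => q * tail a k)%C.
    rewrite (psum_ext n (fun k => q * tail a k)%C
               (fun k => q * tail a k + 0)%C) by (intros; ring).
    rewrite psum_lin, psum_zero. ring.
  + apply bigO_scal, Hf.
Qed.

Definition identity_coef (z0 : C) (k : nat) : C :=
  match k with 0%nat => z0 | 1%nat => RtoC 1 | _ => RtoC 0 end.

Lemma expands_at_id (z0 : C) :
  expands_at (fun z => z) z0 (identity_coef z0).
Proof.
set (a := identity_coef z0).
intros [|[|n]].
- apply (bigO_ext 0 (fun h => z0 + 1 * h))%C; [intros h; simpl; ring|].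
  apply (bigO_plus 0 (fun _ => z0)); [apply bigO_const|].
  apply bigO_scal, bigO_weaken.
  apply (bigO_ext 1 (fun h => h ^ 1)%C); [intros h; simpl; ring|apply bigO_pow].
- apply (bigO_ext 1 (fun h => h ^ 1))%C; [intros h; simpl; ring|apply bigO_pow].
- apply (bigO_ext _ (fun h => 0 * h ^ (S (S n))))%C.
  + intros h.
    change (psum (S (S n)) a h)
      with (z0 + h * (1 + h * psum n (fun _ => RtoC 0) h))%C.
    rewrite psum_zero. ring.
  + apply bigO_scal, bigO_pow.
Qed.

(** The values stay above |a_0| / 2 close to z0. *)
Lemma bigO_inv (f : C -> C) (z0 : C) (a : nat -> C) :
  expands_at f z0 a -> a O <> RtoC 0 ->
  exists r, 0 < r /\ (forall h, Cmod h < r -> f (z0 + h)%C <> RtoC 0) /\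
    bigO 0 (fun h => / f (z0 + h))%C.
Proof.
intros Hf Ha. destruct (Hf 1%nat) as (K & d & HK & Hd & H).
assert (Hm : 0 < Cmod (a O)) by now apply Cmod_gt_0.
set (m := Cmod (a O)) in *.
set (r := Rmin d (m / (2 * (K + 1)))).
assert (Hr : 0 < r).
{ apply Rmin_pos; auto. apply Rdiv_lt_0_compat; lra. }
assert (Hlow : forall h, Cmod h < r -> m / 2 <= Cmod (f (z0 + h)%C)).
{ intros h Hh.
  assert (H1 : Cmod h < d) by (eapply Rlt_le_trans; [exact Hh|apply Rmin_l]).
  assert (H2 : Cmod h < m / (2 * (K + 1)))
    by (eapply Rlt_le_trans; [exact Hh|apply Rmin_r]).
  specialize (H h H1). simpl in H.
  assert (H3 : Cmod h * (2 * (K + 1)) < m).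
  { replace m with (m / (2 * (K + 1)) * (2 * (K + 1))) by (field; lra).
    apply Rmult_lt_compat_r; lra. }
  assert (H4 : m <= Cmod (f (z0 + h)%C)
               + Cmod (f (z0 + h) - (a O + h * 0))%C).
  { unfold m. replace (a O)
      with (f (z0 + h) + - (f (z0 + h) - (a O + h * 0)))%C at 1 by ring.
    rewrite <- (Cmod_opp (f (z0 + h) - (a O + h * 0))%C).
    apply Cmod_triangle. }
  generalize (Cmod_ge_0 h). nra. }
assert (Hne : forall h, Cmod h < r -> f (z0 + h)%C <> RtoC 0).
{ intros h Hh E. specialize (Hlow h Hh). rewrite E, Cmod_0 in Hlow. lra. }
exists r. repeat split; auto.
exists (/ (m / 2)), r. repeat split; auto.
- left. apply Rinv_0_lt_compat. lra.
- intros h Hh. rewrite Cmod_inv by auto. simpl. rewrite Rmult_1_r.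
  apply Rinv_le_contravar; [lra|auto].
Qed.

(** With A, B, Q the partial sums of u, v and of the formal quotient,
    u/v - Q = ((u - A) - Q (v - B) - (Q B - A)) / v. *)
Lemma expands_at_div (u v : C -> C) (z0 : C) (a b : nat -> C) :
  expands_at u z0 a -> expands_at v z0 b -> b O <> RtoC 0 ->
  expands_at (fun z => u z / v z)%C z0 (fdiv a b).
Proof.
intros Hu Hv Hb n. destruct (bigO_inv v z0 b Hv Hb) as (r & Hr & Hne & Hinv).
set (c := fdiv a b).
apply (bigO_near n (fun h => / v (z0 + h)
  * ((u (z0 + h) - psum n a h)
     + (-1 * (psum n c h * (v (z0 + h) - psum n b h))
        + -1 * (psum n c h * psum n b h - psum n (conv c b) h))))%C _ r); auto.
- intros h Hh. rewrite (psum_ext n (conv c b) a).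
  + field. auto.
  + intros k. now apply conv_fdiv.
- apply (bigO_mult 0 n); auto.
  apply bigO_plus; auto. apply bigO_plus; apply bigO_scal.
  + apply (bigO_mult 0 n); auto. apply psum_bigO.
  + apply psum_conv.
Qed.

(** * Division by z and uniqueness of expansions *)

(** (f(z) - f(0)) / z, with the singularity at 0 removed. *)
Definition quotient_at_0 (f : C -> C) (a : nat -> C) : C -> C :=
  fun z => if excluded_middle_informative (z = RtoC 0) then a 1%nat
           else ((f z - a O) / z)%C.

Lemma quotient_at_0_eq (f : C -> C) (a : nat -> C) (z : C) :
  expands_at f 0 a -> f z = (a O + z * quotient_at_0 f a z)%C.
Proof.
intros Hf. unfold quotient_at_0.
destruct (excluded_middle_informative (z = RtoC 0)) as [->|Hz].
- rewrite (expands_at_value f 0 a Hf). ring.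
- field. auto.
Qed.

Lemma quotient_at_0_expands (f : C -> C) (a : nat -> C) :
  expands_at f 0 a -> expands_at (quotient_at_0 f a) 0 (tail a).
Proof.
intros Hf n. destruct (Hf (S n)) as (K & d & HK & Hd & H).
set (x := Cmod (a 1%nat - psum n (tail a) 0)%C).
exists (K + x), d.
assert (Hx : 0 <= x) by apply Cmod_ge_0.
repeat split; auto; [lra|].
intros h Hh. rewrite Cplus_0_l. unfold quotient_at_0.
destruct (excluded_middle_informative (h = RtoC 0)) as [->|Hh0].
- fold x. rewrite Cmod_0. destruct n as [|n]; simpl; [lra|].
  replace x with 0; [lra|]. unfold x. simpl. unfold tail at 1.
  replace (a 1%nat - (a 1%nat + 0 * psum n (tail (tail a)) 0))%C
    with (RtoC 0) by ring. now rewrite Cmod_0.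
- specialize (H h Hh). rewrite Cplus_0_l in H. simpl psum in H.
  assert (Hp : 0 < Cmod h) by now apply Cmod_gt_0.
  replace (f h - (a O + h * psum n (tail a) h))%C
    with (h * ((f h - a O) / h - psum n (tail a) h))%C in H by (field; auto).
  rewrite Cmod_mult in H. simpl in H.
  set (y := Cmod ((f h - a O) / h - psum n (tail a) h)%C) in *.
  assert (y <= K * Cmod h ^ n) by nra.
  generalize (pow_le _ n (Cmod_ge_0 h)). nra.
Qed.

Lemma quotient_at_0_smooth (f : C -> C) (a : nat -> C) :
  smooth_in_disc f -> expands_at f 0 a -> smooth_in_disc (quotient_at_0 f a).
Proof.
intros Hf Ha z0 Hz0.
destruct (excluded_middle_informative (z0 = RtoC 0)) as [->|Hne].
- exists (tail a). now apply quotient_at_0_expands.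
- destruct (Hf z0 Hz0) as (b & Hb).
  exists (fdiv (affine (- a O) 1 b) (identity_coef z0)).
  apply (expands_at_near (fun z => (- a O + 1 * f z) / z)%C _ z0 _ (Cmod z0)).
  + now apply Cmod_gt_0.
  + intros h Hh. unfold quotient_at_0.
    destruct (excluded_middle_informative (z0 + h = RtoC 0)%C) as [E|E].
    * exfalso. replace h with (- z0 + (z0 + h))%C in Hh by ring.
      rewrite E, Cplus_0_r, Cmod_opp in Hh. lra.
    * field. auto.
  + apply expands_at_div; auto.
    * now apply expands_at_affine.
    * apply expands_at_id.
Qed.

(** The first step towards uniqueness: the coefficient of order 1 is the value
    at 0 of the quotient by z, so the two expansions of f define the same
    quotient, and the comparison can go on with it. *)
Lemma expands_at_coef1 (f : C -> C) (a b : nat -> C) :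
  expands_at f 0 a -> expands_at f 0 b -> a 1%nat = b 1%nat.
Proof.
intros Ha Hb.
assert (H0 : a O = b O).
{ now rewrite <- (expands_at_value f 0 a), <- (expands_at_value f 0 b). }
assert (H : bigO 2 (fun h => h * (b 1%nat - a 1%nat))%C).
{ apply (bigO_ext 2 (fun h => (f (0 + h) - psum 2 a h)
                        + -1 * (f (0 + h) - psum 2 b h)))%C.
  - intros h. simpl. unfold tail. rewrite H0. ring.
  - apply bigO_plus; auto. now apply bigO_scal. }
destruct H as (K & d & HK & Hd & H).
destruct (Req_dec (Cmod (b 1%nat - a 1%nat)%C) 0) as [E|E].
- apply Cmod_eq_0 in E.
  transitivity (b 1%nat - (b 1%nat - a 1%nat))%C; [ring|]. rewrite E; ring.
- exfalso. set (x := Cmod (b 1%nat - a 1%nat)%C) in *.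
  assert (Hx : 0 <= x) by apply Cmod_ge_0.
  set (t := Rmin (d / 2) (x / (2 * (K + 1)))).
  assert (Ht : 0 < t).
  { apply Rmin_pos; [lra|]. apply Rdiv_lt_0_compat; lra. }
  assert (Ht1 : t <= d / 2) by apply Rmin_l.
  assert (Ht2 : t * (2 * (K + 1)) <= x).
  { apply Rle_trans with (x / (2 * (K + 1)) * (2 * (K + 1))).
    - apply Rmult_le_compat_r; [lra|apply Rmin_r].
    - right; field; lra. }
  specialize (H (RtoC t)). rewrite Cmod_mult in H. fold x in H.
  rewrite Cmod_R, Rabs_pos_eq in H by lra.
  specialize (H ltac:(lra)). nra.
Qed.

Lemma expands_at_unique (f : C -> C) (a b : nat -> C) (k : nat) :
  expands_at f 0 a -> expands_at f 0 b -> a k = b k.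
Proof.
revert f a b; induction k as [|k IH]; intros f a b Ha Hb.
- now rewrite <- (expands_at_value f 0 a), <- (expands_at_value f 0 b).
- apply (IH (quotient_at_0 f a) (tail a) (tail b)).
  + now apply quotient_at_0_expands.
  + replace (quotient_at_0 f a) with (quotient_at_0 f b).
    * now apply quotient_at_0_expands.
    * assert (H0 : a O = b O).
      { now rewrite <- (expands_at_value f 0 a), <- (expands_at_value f 0 b). }
      assert (H1 : a 1%nat = b 1%nat).
      { apply expands_at_coef1 with (f := f); auto. }
      unfold quotient_at_0. now rewrite H0, H1.
Qed.

(** * Power series have asymptotic expansions *)

Lemma sum_n_psum (a : nat -> C) (h : C) (n : nat) :
  sum_n (fun k => scal (pow_n h k) (a k)) n = psum (S n) a h.
Proof.
assert (Hp : forall k, pow_n h k = (h ^ k)%C).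
{ induction k as [|k IH]; simpl; [reflexivity|]. now rewrite IH. }
induction n as [|n IH].
- rewrite sum_O, Hp, psum_last. simpl.
  change (1 * a O = 0 + a O * 1)%C. ring.
- rewrite sum_Sn, IH, Hp, (psum_last (S n)).
  change (psum (S n) a h + h ^ (S n) * a (S n)
          = psum (S n) a h + a (S n) * h ^ (S n))%C. ring.
Qed.

Lemma is_pseries_psum (a : nat -> C) (h l : C) :
  is_pseries a h l <->
  forall eps, 0 < eps ->
    exists N, forall n, (N <= n)%nat -> Cmod (psum (S n) a h - l)%C < eps.
Proof.
unfold is_pseries, is_series.
rewrite (filterlim_locally_ball_norm (K := C_AbsRing) (U := C_NormedModule)).
split.
- intros H eps Heps. destruct (H (mkposreal eps Heps)) as (N & HN).
  exists N. intros n Hn. rewrite <- sum_n_psum. exact (HN n Hn).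
- intros H eps. destruct (H eps (cond_pos eps)) as (N & HN).
  exists N. intros n Hn. unfold ball_norm.
  rewrite sum_n_psum. exact (HN n Hn).
Qed.

(** Convergent partial sums have bounded differences. *)
Lemma pseries_terms_bounded (a : nat -> C) (h l : C) :
  is_pseries a h l -> exists M, forall k, Cmod (a k) * Cmod h ^ k <= M.
Proof.
rewrite is_pseries_psum. intros H.
destruct (H 1 ltac:(lra)) as (N & HN).
assert (Hfin : exists M, forall k, (k <= S N)%nat -> Cmod (a k) * Cmod h ^ k <= M).
{ generalize (S N). induction n as [|n (M & HM)].
  - exists (Cmod (a O) * Cmod h ^ 0). intros k Hk. replace k with O by lia. lra.
  - exists (Rmax M (Cmod (a (S n)) * Cmod h ^ S n)). intros k Hk.
    destruct (Nat.eq_dec k (S n)) as [->|].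
    + apply Rmax_r.
    + eapply Rle_trans; [apply HM; lia|apply Rmax_l]. }
destruct Hfin as (M & HM).
exists (Rmax M 2). intros k. destruct (Nat.le_gt_cases k (S N)) as [Hk|Hk].
- eapply Rle_trans; [apply HM; lia|apply Rmax_l].
- eapply Rle_trans; [|apply Rmax_r].
  destruct k as [|[|k]]; try lia.
  rewrite <- Cmod_pow, <- Cmod_mult.
  replace (a (S (S k)) * h ^ (S (S k)))%C
    with ((psum (S (S (S k))) a h - l) + - (psum (S (S k)) a h - l))%C
    by (rewrite (psum_last (S (S k))); ring).
  eapply Rle_trans; [apply Cmod_triangle|]. rewrite Cmod_opp.
  generalize (HN (S (S k)) ltac:(lia)) (HN (S k) ltac:(lia)). lra.
Qed.

Lemma psum_geometric_bound (a : nat -> C) (M rho : R) (n : nat) (h : C) :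
  0 < rho -> 2 * Cmod h <= rho ->
  (forall k, Cmod (a k) * rho ^ k <= M) -> Cmod (psum n a h) <= 2 * M.
Proof.
intros Hrho Hh. revert a M. induction n as [|n IH]; intros a M Ha.
- simpl. rewrite Cmod_0. generalize (Ha O) (Cmod_ge_0 (a O)). simpl. lra.
- simpl. eapply Rle_trans; [apply Cmod_triangle|]. rewrite Cmod_mult.
  assert (H1 : Cmod (psum n (tail a) h) <= 2 * (M / rho)).
  { apply IH. intros k.
    apply Rmult_le_reg_r with rho; auto.
    replace (M / rho * rho) with M by (field; lra).
    unfold tail. eapply Rle_trans; [|apply (Ha (S k))]. right; simpl; ring. }
  assert (H0 : Cmod (a O) <= M) by (generalize (Ha O); simpl; lra).
  assert (H2 : Cmod h * Cmod (psum n (tail a) h) <= rho / 2 * (2 * (M / rho))).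
  { apply Rmult_le_compat; auto using Cmod_ge_0. lra. }
  replace (rho / 2 * (2 * (M / rho))) with M in H2 by (field; lra). lra.
Qed.

(** Convergence at one point at distance rho = r/2 bounds the coefficients by
    M / rho^k, hence the tail of order n by a multiple of |h|^n for
    |h| < rho / 2. *)
Lemma expands_at_of_pseries (f : C -> C) (z0 : C) (a : nat -> C) (r : R) :
  0 < r ->
  (forall h, Cmod h < r -> is_pseries a h (f (z0 + h)%C)) ->
  expands_at f z0 a.
Proof.
intros Hr Hf n. set (rho := r / 2).
assert (Hrho : 0 < rho) by (unfold rho; lra).
assert (Hm : Cmod (RtoC rho) = rho) by (rewrite Cmod_R, Rabs_pos_eq; lra).
destruct (pseries_terms_bounded a (RtoC rho) (f (z0 + RtoC rho)%C)) as (M & HM).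
{ apply Hf. rewrite Hm. unfold rho; lra. }
rewrite Hm in HM.
assert (HM0 : 0 <= M).
{ generalize (HM O) (Cmod_ge_0 (a O)). simpl. lra. }
assert (Hpn : 0 < rho ^ n) by now apply pow_lt.
exists (2 * (M / rho ^ n)), (rho / 2). repeat split; [|lra|].
{ apply Rmult_le_pos; [lra|]. apply Rmult_le_pos; auto.
  left; now apply Rinv_0_lt_compat. }
intros h Hh. apply le_epsilon. intros eps Heps.
assert (Hp := Hf h ltac:(unfold rho in *; lra)). rewrite is_pseries_psum in Hp.
destruct (Hp eps Heps) as (N & HN). specialize (HN (n + N)%nat ltac:(lia)).
replace (f (z0 + h) - psum n a h)%C
  with (h ^ n * psum (S N) (fun k => a (n + k)%nat) h
        + - (psum (S (n + N)) a h - f (z0 + h)))%C.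
- eapply Rle_trans; [apply Cmod_triangle|]. rewrite Cmod_opp, Cmod_mult, Cmod_pow.
  apply Rplus_le_compat; [|lra].
  rewrite Rmult_comm. apply Rmult_le_compat_r; [apply pow_le, Cmod_ge_0|].
  apply psum_geometric_bound with rho; auto; [lra|].
  intros k. apply Rmult_le_reg_r with (rho ^ n); auto.
  replace (M / rho ^ n * rho ^ n) with M by (field; lra).
  eapply Rle_trans; [|apply (HM (n + k)%nat)]. rewrite pow_add. right; ring.
- replace (S (n + N)) with (n + S N)%nat by lia. rewrite psum_add. ring.
Qed.

Lemma analytic_smooth (f : C -> C) :
  analytic_in_disc f -> smooth_in_disc f.
Proof.
intros Hf z0 Hz0. destruct (Hf z0 Hz0) as (a & (d & Hd)).
exists a. apply expands_at_of_pseries with d; [apply cond_pos|].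
intros h Hh. replace h with (z0 + h - z0)%C at 1 by ring.
apply Hd. apply C_NormedModule_mixin_compat1.
change (Cmod (z0 + h - z0)%C < d). now replace (z0 + h - z0)%C with h by ring.
Qed.

Lemma expansion_expands_at_0 (f : C -> C) (a : nat -> C) :
  has_expansion f a -> expands_at f 0 a.
Proof.
intros Hf. apply expands_at_of_pseries with 1; [lra|].
intros h Hh. replace (0 + h)%C with h by ring. now apply Hf.
Qed.

(** * The maximum principle *)

Lemma Cmod_lt_of_coordinates (z : C) (d : R) :
  Rabs (fst z) < d / 2 -> Rabs (snd z) < d / 2 -> Cmod z < d.
Proof.
intros H1 H2. apply Rle_lt_trans with (1 := Cmod_2Rmax z).
assert (Hm : Rmax (Rabs (fst z)) (Rabs (snd z)) < d / 2) by now apply Rmax_lub_lt.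
assert (Hq : sqrt 2 < 2).
{ rewrite <- (sqrt_pow2 2) at 2 by lra. apply sqrt_lt_1; lra. }
generalize (sqrt_pos 2)
  (Rle_trans _ _ _ (Rabs_pos _) (Rmax_l (Rabs (fst z)) (Rabs (snd z)))). nra.
Qed.

(** Compactness of the closed disc: each point is the centre of a square on
    which g exceeds half its value at the centre. The size of the square is also
    chosen no larger than that value, which turns the positive lower bound for
    the sizes into one for g. *)
Lemma disc_positive_lower_bound (g : C -> R) (s : R) :
  (forall z, Cmod z <= s -> 0 < g z) ->
  (forall z, Cmod z <= s -> exists d, 0 < d /\
     forall z', Cmod z' <= s -> Cmod (z' - z)%C < d -> g z < 2 * g z') ->
  exists m, 0 < m /\ forall z, Cmod z <= s -> m <= g z.
Proof.
intros Hg Hloc.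
assert (Hdel : forall z : C, exists d : posreal,
  forall z', Cmod z' <= s ->
    Rabs (fst z' - fst z) < d -> Rabs (snd z' - snd z) < d ->
    d <= 2 * g z').
{ intros z. destruct (Rle_lt_dec (Cmod z) s) as [Hz|Hz].
  - destruct (Hloc z Hz) as (d & Hd & H).
    assert (Hp : 0 < Rmin (d / 2) (g z)) by (apply Rmin_pos; auto; lra).
    exists (mkposreal _ Hp). simpl. intros z' Hz' H1 H2.
    apply Rle_trans with (g z); [apply Rmin_r|]. left. apply H; auto.
    apply Cmod_lt_of_coordinates.
    + eapply Rlt_le_trans; [exact H1|apply Rmin_l].
    + eapply Rlt_le_trans; [exact H2|apply Rmin_l].
  - assert (Hp : 0 < (Cmod z - s) / 2) by lra.
    (* near a point outside the closed disc there is no point of the disc *)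
    exists (mkposreal _ Hp). simpl. intros z' Hz' H1 H2. exfalso.
    assert (H4 := Cmod_lt_of_coordinates (z' - z)%C _ H1 H2).
    assert (H5 : Cmod z <= Cmod z' + Cmod (z' - z)%C).
    { replace z with (z' + - (z' - z))%C at 1 by ring.
      rewrite <- (Cmod_opp (z' - z)%C). apply Cmod_triangle. }
    lra. }
set (del := fun z => proj1_sig (constructive_indefinite_description _ (Hdel z))).
assert (Hdel' : forall z z', Cmod z' <= s ->
  Rabs (fst z' - fst z) < del z -> Rabs (snd z' - snd z) < del z ->
  del z <= 2 * g z').
{ intros z. exact (proj2_sig (constructive_indefinite_description _ (Hdel z))). }
destruct (compactness_value_2d (- s) s (- s) s (fun x y => del (x, y)))
  as (m & Hm).
exists (m / 2). split; [generalize (cond_pos m); lra|].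
intros z Hz. apply Rnot_lt_le. intros Hlt.
assert (Hx : Rabs (fst z) <= s /\ Rabs (snd z) <= s).
{ generalize (Rmax_Cmod z) (Rmax_l (Rabs (fst z)) (Rabs (snd z)))
    (Rmax_r (Rabs (fst z)) (Rabs (snd z))). lra. }
destruct Hx as (Hx & Hy). apply Rabs_le_between in Hx, Hy.
apply (Hm (fst z) (snd z) Hx Hy). intros (x & y & _ & _ & H1 & H2 & H3).
generalize (Hdel' (x, y) z Hz H1 H2). simpl in H3. lra.
Qed.

(** Extreme value theorem, by two uses of [disc_positive_lower_bound]: on
    1 / (1 + max(u, 0)) for an upper bound of u, then on sup u - u, which
    would be positive everywhere if the supremum were not attained. *)
Lemma disc_maximum (u : C -> R) (s : R) : 0 <= s ->
  (forall z, Cmod z <= s -> forall eps, 0 < eps -> exists d, 0 < d /\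
     forall z', Cmod z' <= s -> Cmod (z' - z)%C < d -> Rabs (u z' - u z) < eps) ->
  exists z0, Cmod z0 <= s /\ forall z, Cmod z <= s -> u z <= u z0.
Proof.
intros Hs Hu.
assert (Hbound : exists B, forall z, Cmod z <= s -> u z <= B).
{ destruct (disc_positive_lower_bound (fun z => / (1 + Rmax (u z) 0)) s) as (m & Hm & H).
  - intros z _. apply Rinv_0_lt_compat. generalize (Rmax_r (u z) 0). lra.
  - intros z Hz. destruct (Hu z Hz 1 ltac:(lra)) as (d & Hd & H).
    exists d. split; auto. intros z' Hz' Hzz.
    specialize (H z' Hz' Hzz). apply Rabs_def2 in H.
    assert (H1 := Rmax_r (u z) 0). assert (H2 := Rmax_r (u z') 0).
    assert (H3 : Rmax (u z') 0 < 1 + Rmax (u z) 0).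
    { apply Rmax_lub_lt; generalize (Rmax_l (u z) 0); lra. }
    set (p := Rmax (u z) 0) in *. set (q := Rmax (u z') 0) in *.
    apply Rmult_lt_reg_r with ((1 + p) * (1 + q)); [nra|].
    replace (/ (1 + p) * ((1 + p) * (1 + q))) with (1 + q) by (field; lra).
    replace (2 * / (1 + q) * ((1 + p) * (1 + q))) with (2 * (1 + p)) by (field; lra).
    lra.
  - exists (/ m). intros z Hz. specialize (H z Hz).
    assert (H2 := Rmax_r (u z) 0). assert (H3 := Rmax_l (u z) 0).
    set (q := Rmax (u z) 0) in *.
    apply Rmult_le_compat_r with (r := (1 + q)) in H; [|lra].
    replace (/ (1 + q) * (1 + q)) with 1 in H by (field; lra).
    apply Rmult_le_reg_l with m; auto. rewrite Rinv_r by lra. nra. }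
destruct Hbound as (B & HB).
destruct (completeness (fun y => exists z, Cmod z <= s /\ y = u z))
  as (S & HS1 & HS2).
{ exists B. intros y (z & Hz & ->). auto. }
{ exists (u 0), 0%C. rewrite Cmod_0. auto. }
apply NNPP. intros Hno.
assert (Hlt : forall z, Cmod z <= s -> u z < S).
{ intros z Hz. destruct (HS1 (u z)) as [H|H]; auto.
  - exists z; auto.
  - exfalso. apply Hno. exists z. split; auto. intros z' Hz'.
    rewrite H. apply HS1. exists z'; auto. }
destruct (disc_positive_lower_bound (fun z => S - u z) s) as (m & Hm & H).
- intros z Hz. specialize (Hlt z Hz). lra.
- intros z Hz. specialize (Hlt z Hz).
  destruct (Hu z Hz ((S - u z) / 2) ltac:(lra)) as (d & Hd & H).
  exists d. split; auto. intros z' Hz' Hzz.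
  specialize (H z' Hz' Hzz). apply Rabs_def2 in H. lra.
- assert (S <= S - m); [|lra].
  apply HS2. intros y (z & Hz & ->). specialize (H z Hz). lra.
Qed.

Lemma smooth_continuous (g : C -> C) (z : C) :
  smooth_in_disc g -> unit_disc z ->
  forall eps, 0 < eps -> exists d, 0 < d /\
    forall z', Cmod (z' - z)%C < d -> Cmod (g z' - g z)%C < eps.
Proof.
intros Hg Hz eps Heps. destruct (Hg z Hz) as (a & Ha).
rewrite (expands_at_value g z a Ha).
destruct (Ha 1%nat) as (K & d & HK & Hd & H).
assert (Hq : 0 < eps / (K + 1)) by (apply Rdiv_lt_0_compat; lra).
exists (Rmin d (eps / (K + 1))). split; [now apply Rmin_pos|].
intros z' Hz'.
assert (H1 : Cmod (z' - z)%C < d) by (eapply Rlt_le_trans; [exact Hz'|apply Rmin_l]).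
assert (H2 : Cmod (z' - z)%C < eps / (K + 1))
  by (eapply Rlt_le_trans; [exact Hz'|apply Rmin_r]).
specialize (H _ H1). simpl in H.
replace (z + (z' - z))%C with z' in H by ring.
replace (g z' - (a O + (z' - z) * 0))%C with (g z' - a O)%C in H by ring.
apply Rle_lt_trans with (1 := H).
assert (H3 : Cmod (z' - z)%C * (K + 1) < eps).
{ replace eps with (eps / (K + 1) * (K + 1)) by (field; lra).
  apply Rmult_lt_compat_r; lra. }
generalize (Cmod_ge_0 (z' - z)%C). nra.
Qed.

Lemma Cmod_sqr_continuous (x : C) (eps : R) : 0 < eps ->
  exists d, 0 < d /\ forall y : C, Cmod (y - x)%C < d ->
    Rabs (Cmod y ^ 2 - Cmod x ^ 2) < eps.
Proof.
intros Heps. assert (Hx := Cmod_ge_0 x).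
assert (Hq : 0 < eps / (2 * Cmod x + 2)) by (apply Rdiv_lt_0_compat; lra).
exists (Rmin 1 (eps / (2 * Cmod x + 2))). split; [apply Rmin_pos; lra|].
intros y Hy.
assert (H1 : Cmod (y - x)%C < 1) by (eapply Rlt_le_trans; [exact Hy|apply Rmin_l]).
assert (H2 : Cmod (y - x)%C < eps / (2 * Cmod x + 2))
  by (eapply Rlt_le_trans; [exact Hy|apply Rmin_r]).
assert (H3 : Cmod (y - x)%C * (2 * Cmod x + 2) < eps).
{ replace eps with (eps / (2 * Cmod x + 2) * (2 * Cmod x + 2)) by (field; lra).
  apply Rmult_lt_compat_r; lra. }
assert (H4 : Cmod y <= Cmod x + Cmod (y - x)%C).
{ replace y with (x + (y - x))%C at 1 by ring. apply Cmod_triangle. }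
assert (H5 : Cmod x <= Cmod y + Cmod (y - x)%C).
{ replace x with (y + - (y - x))%C at 1 by ring.
  rewrite <- (Cmod_opp (y - x)%C). apply Cmod_triangle. }
assert (Hy0 := Cmod_ge_0 y). assert (Hd0 := Cmod_ge_0 (y - x)%C).
apply Rabs_def1; nra.
Qed.

(** |g|^2 >= |c|^2 + 2 Re (conj c (g - c)), summed over four values. *)
Lemma four_point_mean (c g1 g2 g3 g4 : C) :
  4 * Cmod c ^ 2 - 2 * (Cmod c * Cmod (g1 + g2 + g3 + g4 - 4 * c)%C)
  <= Cmod g1 ^ 2 + Cmod g2 ^ 2 + Cmod g3 ^ 2 + Cmod g4 ^ 2.
Proof.
assert (H : - (Cmod c * Cmod (g1 + g2 + g3 + g4 - 4 * c)%C)
            <= Re (Cconj c * (g1 + g2 + g3 + g4 - 4 * c))%C).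
{ rewrite <- (Cmod_conj c), <- Cmod_mult.
  generalize (re_le_Cmod (Cconj c * (g1 + g2 + g3 + g4 - 4 * c))%C).
  intros H. apply Rabs_le_between in H. lra. }
apply Rle_trans
  with (4 * Cmod c ^ 2 + 2 * Re (Cconj c * (g1 + g2 + g3 + g4 - 4 * c))%C); [lra|].
clear H. rewrite !Cmod2_alt.
destruct c as [x y], g1 as [x1 y1], g2 as [x2 y2], g3 as [x3 y3], g4 as [x4 y4].
unfold Re, Im, Cconj, Cminus, Cplus, Copp, Cmult, RtoC; simpl.
apply Rminus_le.
match goal with |- ?e <= 0 => replace e with
  (- ((x1 - x) ^ 2 + (y1 - y) ^ 2 + (x2 - x) ^ 2 + (y2 - y) ^ 2
    + (x3 - x) ^ 2 + (y3 - y) ^ 2 + (x4 - x) ^ 2 + (y4 - y) ^ 2)) by ring end.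
generalize (pow2_ge_0 (x1 - x)) (pow2_ge_0 (y1 - y)) (pow2_ge_0 (x2 - x))
 (pow2_ge_0 (y2 - y)) (pow2_ge_0 (x3 - x)) (pow2_ge_0 (y3 - y))
 (pow2_ge_0 (x4 - x)) (pow2_ge_0 (y4 - y)). lra.
Qed.

Lemma Ci_mult_Ci : (Ci * Ci = -1)%C.
Proof. unfold Ci, Cmult, RtoC, Copp; simpl. f_equal; ring. Qed.

(** Average |g|^2 + eps |z|^2 over z0 + t, z0 + i t, z0 - t, z0 - i t: the terms
    of degree 1 and 2 of the expansion of g cancel, so |g|^2 loses at most
    O(t^3) against its value at z0 while eps |z|^2 gains eps t^2. *)
Lemma stencil_gain (g : C -> C) (z0 : C) (a : nat -> C) (eps : R) :
  expands_at g z0 a -> 0 < eps -> forall r, 0 < r ->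
  exists h : C, Cmod h < r /\
    Cmod (g z0) ^ 2 + eps * Cmod z0 ^ 2
    < Cmod (g (z0 + h)%C) ^ 2 + eps * Cmod (z0 + h)%C ^ 2.
Proof.
intros Ha Heps r Hr.
destruct (Ha 3%nat) as (K & d & HK & Hd & H).
rewrite (expands_at_value g z0 a Ha).
set (m := Cmod (a O)). assert (Hm : 0 <= m) by apply Cmod_ge_0.
set (t := Rmin (Rmin (r / 2) (d / 2)) (eps / (2 * (m * K) + 1))).
assert (HmK : 0 <= m * K) by nra.
assert (Ht : 0 < t).
{ apply Rmin_pos; [apply Rmin_pos; lra|]. apply Rdiv_lt_0_compat; lra. }
assert (Htr : t < r).
{ apply Rle_lt_trans with (r / 2); [|lra].
  eapply Rle_trans; [apply Rmin_l|apply Rmin_l]. }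
assert (Htd : t < d).
{ apply Rle_lt_trans with (d / 2); [|lra].
  eapply Rle_trans; [apply Rmin_l|apply Rmin_r]. }
assert (Hte : t * (2 * (m * K) + 1) <= eps).
{ apply Rle_trans with (eps / (2 * (m * K) + 1) * (2 * (m * K) + 1)).
  - apply Rmult_le_compat_r; [lra|apply Rmin_r].
  - right; field; lra. }
set (h1 := RtoC t). set (h2 := (Ci * RtoC t)%C).
set (h3 := (- RtoC t)%C). set (h4 := (- (Ci * RtoC t))%C).
assert (E1 : Cmod h1 = t) by (unfold h1; rewrite Cmod_R, Rabs_pos_eq; lra).
assert (E2 : Cmod h2 = t).
{ unfold h2. rewrite Cmod_mult, Cmod_Ci, Cmod_R, Rabs_pos_eq; lra. }
assert (E3 : Cmod h3 = t) by (unfold h3; rewrite Cmod_opp; exact E1).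
assert (E4 : Cmod h4 = t) by (unfold h4; rewrite Cmod_opp; exact E2).
assert (R1 := H h1 ltac:(lra)). assert (R2 := H h2 ltac:(lra)).
assert (R3 := H h3 ltac:(lra)). assert (R4 := H h4 ltac:(lra)).
rewrite E1 in R1. rewrite E2 in R2. rewrite E3 in R3. rewrite E4 in R4.
set (S := (g (z0 + h1) + g (z0 + h2) + g (z0 + h3) + g (z0 + h4) - 4 * a O)%C).
assert (HS : Cmod S <= 4 * (K * t ^ 3)).
{ replace S with ((g (z0 + h1) - psum 3 a h1) + (g (z0 + h2) - psum 3 a h2)
    + (g (z0 + h3) - psum 3 a h3) + (g (z0 + h4) - psum 3 a h4))%C.
  - eapply Rle_trans; [apply Cmod_triangle|].
    generalize (Cmod_triangle ((g (z0 + h1) - psum 3 a h1)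
      + (g (z0 + h2) - psum 3 a h2))%C (g (z0 + h3) - psum 3 a h3)%C)
     (Cmod_triangle (g (z0 + h1) - psum 3 a h1)%C (g (z0 + h2) - psum 3 a h2)%C).
    lra.
  - unfold S. simpl psum. unfold tail, h1, h2, h3, h4.
    (* the first and second powers of the four increments cancel *)
    transitivity (g (z0 + t) + g (z0 + Ci * t) + g (z0 + - t)
       + g (z0 + - (Ci * t)) - 4 * a O
       - 2 * (RtoC t * RtoC t) * (1 + Ci * Ci) * a 2%nat)%C; [ring|].
    rewrite Ci_mult_Ci. ring. }
assert (HZ : Cmod (z0 + h1)%C ^ 2 + Cmod (z0 + h2)%C ^ 2 + Cmod (z0 + h3)%C ^ 2
   + Cmod (z0 + h4)%C ^ 2 = 4 * Cmod z0 ^ 2 + 4 * t ^ 2).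
{ rewrite !Cmod2_alt. unfold h1, h2, h3, h4. destruct z0.
  unfold Re, Im, Cplus, Copp, Cmult, Ci, RtoC; simpl. ring. }
assert (HM := four_point_mean (a O) (g (z0 + h1)%C) (g (z0 + h2)%C)
                (g (z0 + h3)%C) (g (z0 + h4)%C)).
fold S m in HM.
assert (Hgain : 2 * (m * Cmod S) < 4 * (eps * t ^ 2)).
{ apply Rle_lt_trans with (2 * (m * (4 * (K * t ^ 3)))).
  - apply Rmult_le_compat_l; [lra|]. apply Rmult_le_compat_l; auto.
  - replace (2 * (m * (4 * (K * t ^ 3)))) with (4 * (t * (2 * (m * K)) * t ^ 2)) by ring.
    apply Rmult_lt_compat_l; [lra|]. apply Rmult_lt_compat_r; [nra|]. lra. }
apply NNPP. intros Hno.
assert (Hle : forall h, Cmod h = t ->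
  Cmod (g (z0 + h)%C) ^ 2 + eps * Cmod (z0 + h)%C ^ 2
  <= m ^ 2 + eps * Cmod z0 ^ 2).
{ intros h Hh. apply Rnot_lt_le. intros Hlt. apply Hno. exists h. split; auto. lra. }
generalize (Hle h1 E1) (Hle h2 E2) (Hle h3 E3) (Hle h4 E4). nra.
Qed.

(** By [stencil_gain], |g|^2 + eps |z|^2 takes its maximum over the closed disc
    on the boundary circle; then eps tends to 0. *)
Lemma maximum_principle (g : C -> C) (s M : R) :
  smooth_in_disc g -> 0 <= s < 1 -> 0 <= M ->
  (forall z, Cmod z = s -> Cmod (g z) <= M) ->
  forall z, Cmod z <= s -> Cmod (g z) <= M.
Proof.
intros Hg Hs HM Hcirc z Hz.
assert (Hsq : Cmod (g z) ^ 2 <= M ^ 2).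
{ apply le_epsilon. intros eps Heps.
  destruct (disc_maximum (fun z => Cmod (g z) ^ 2 + eps * Cmod z ^ 2) s)
    as (z0 & Hz0 & Hmax); [lra| |].
  - intros x Hx e He.
    assert (Hxd : unit_disc x) by (unfold unit_disc; lra).
    destruct (Cmod_sqr_continuous (g x) (e / 2) ltac:(lra)) as (d1 & Hd1 & H1).
    destruct (smooth_continuous g x Hg Hxd d1 Hd1) as (d2 & Hd2 & H2).
    destruct (Cmod_sqr_continuous x (e / (2 * eps))) as (d3 & Hd3 & H3).
    { apply Rdiv_lt_0_compat; lra. }
    exists (Rmin d2 d3). split; [now apply Rmin_pos|]. intros y _ Hy.
    assert (K1 := H1 (g y) (H2 y ltac:(eapply Rlt_le_trans; [exact Hy|apply Rmin_l]))).
    assert (K2 := H3 y ltac:(eapply Rlt_le_trans; [exact Hy|apply Rmin_r])).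
    apply Rabs_def2 in K1, K2.
    assert (Hee : e / (2 * eps) * eps = e / 2) by (field; lra).
    apply Rabs_def1; nra.
  - assert (Hb : Cmod z0 = s).
    { destruct (Rle_lt_or_eq_dec _ _ Hz0) as [Hlt|]; auto. exfalso.
      destruct (Hg z0 ltac:(unfold unit_disc; lra)) as (a & Ha).
      destruct (stencil_gain g z0 a eps Ha Heps (s - Cmod z0) ltac:(lra))
        as (h & Hh & Hgt).
      assert (Hin : Cmod (z0 + h)%C <= s).
      { eapply Rle_trans; [apply Cmod_triangle|]. lra. }
      specialize (Hmax _ Hin). simpl in Hmax, Hgt. lra. }
    specialize (Hmax z Hz). simpl in Hmax.
    specialize (Hcirc z0 Hb). rewrite Hb in Hmax.
    assert (H1 := Cmod_ge_0 (g z0)). assert (H2 := Cmod_ge_0 z).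
    assert (Cmod (g z0) ^ 2 <= M ^ 2) by (apply pow_incr; lra).
    assert (s ^ 2 <= 1) by nra.
    assert (0 <= Cmod z ^ 2) by apply pow2_ge_0. simpl in *. nra. }
generalize (Cmod_ge_0 (g z)). intros H0. apply Rnot_lt_le. intros Hn. nra.
Qed.

(** * The Schur algorithm *)

Definition bounded_by_1 (f : C -> C) : Prop :=
  forall z, unit_disc z -> Cmod (f z) <= 1.

(** Schwarz's lemma: on |z| = s the quotient is at most 1/s, and s tends to 1. *)
Lemma schwarz_quotient (om : C -> C) (a : nat -> C) :
  smooth_in_disc om -> bounded_by_1 om -> expands_at om 0 a -> a O = RtoC 0 ->
  bounded_by_1 (quotient_at_0 om a).
Proof.
intros Hom Hb Ha Ha0 z Hz. set (q := quotient_at_0 om a).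
assert (Hs : forall s, Cmod z <= s -> 0 < s < 1 -> Cmod (q z) <= / s).
{ intros s Hzs Hs. apply maximum_principle with (s := s); auto; try lra.
  - now apply quotient_at_0_smooth.
  - left. apply Rinv_0_lt_compat. lra.
  - intros x Hx. apply Rmult_le_reg_l with s; [lra|]. rewrite Rinv_r by lra.
    rewrite <- Hx at 1. rewrite <- Cmod_mult.
    replace (x * q x)%C with (om x); [apply Hb; unfold unit_disc; lra|].
    rewrite (quotient_at_0_eq om a x Ha), Ha0. fold q. ring. }
apply Rnot_lt_le. intros Hgt. unfold unit_disc in Hz.
set (y := Cmod (q z)) in *. assert (Hz0 := Cmod_ge_0 z).
assert (Hy : 0 < / y < 1).
{ split; [apply Rinv_0_lt_compat; lra|].
  rewrite <- Rinv_1. apply Rinv_lt_contravar; lra. }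
assert (Hyy : y * / y = 1) by (field; lra).
set (s := (1 + Rmax (Cmod z) (/ y)) / 2).
assert (Hm1 := Rmax_l (Cmod z) (/ y)). assert (Hm2 := Rmax_r (Cmod z) (/ y)).
assert (Hm3 : Rmax (Cmod z) (/ y) < 1) by (apply Rmax_lub_lt; lra).
assert (H := Hs s ltac:(unfold s; lra) ltac:(unfold s; lra)).
assert (Hsy : / y < s) by (unfold s; lra).
apply Rmult_le_compat_l with (r := s) in H; [|lra].
rewrite Rinv_r in H by lra. nra.
Qed.

Lemma moebius_denominator (w v : C) :
  Cmod w < 1 -> Cmod v <= 1 -> (1 + - Cconj w * v <> 0)%C.
Proof.
intros Hw Hv E.
assert (H : Cmod (Cconj w * v)%C = 1).
{ replace (Cconj w * v)%C with (1 - (1 + - Cconj w * v))%C by ring.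
  rewrite E. replace (1 - 0)%C with (RtoC 1) by ring. apply Cmod_1. }
rewrite Cmod_mult, Cmod_conj in H.
generalize (Cmod_ge_0 w) (Cmod_ge_0 v). nra.
Qed.

(** One step of the Schur algorithm: (w - f) / (1 - conj w f) is bounded by 1
    and vanishes at 0, hence equals z g with g bounded by 1. The last clause is
    the identity z g (1 - conj w f) = w - f between formal power series. *)
Lemma schur_step (f : C -> C) (a : nat -> C) :
  smooth_in_disc f -> bounded_by_1 f -> expands_at f 0 a -> Cmod (a O) < 1 ->
  exists g c, smooth_in_disc g /\ bounded_by_1 g /\ expands_at g 0 c /\
    forall k, conv (shift c) (affine 1 (- Cconj (a O)) a) k
              = affine (a O) (-1) a k.
Proof.
intros Hf Hb Ha Hw. set (w := a O) in *.
set (om := fun z => ((w + -1 * f z) / (1 + - Cconj w * f z))%C).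
set (d := fdiv (affine w (-1) a) (affine 1 (- Cconj w) a)).
assert (Hexp : forall z0 b, unit_disc z0 -> expands_at f z0 b ->
  expands_at om z0 (fdiv (affine w (-1) b) (affine 1 (- Cconj w) b))).
{ intros z0 b Hz0 Hfb.
  apply (expands_at_div (fun z => w + -1 * f z)%C (fun z => 1 + - Cconj w * f z)%C).
  - now apply expands_at_affine.
  - now apply expands_at_affine.
  - simpl. rewrite <- (expands_at_value f z0 b Hfb).
    apply moebius_denominator; auto. }
assert (H0 : unit_disc 0) by (unfold unit_disc; rewrite Cmod_0; lra).
assert (Hom : smooth_in_disc om).
{ intros z0 Hz0. destruct (Hf z0 Hz0) as (b & Hfb).
  eexists. now apply Hexp with (2 := Hfb). }
assert (Homb : bounded_by_1 om).
{ intros z Hz. unfold om. specialize (Hb z Hz).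
  assert (Hne := moebius_denominator w (f z) Hw Hb).
  rewrite Cmod_div by auto.
  assert (Hpos : 0 < Cmod (1 + - Cconj w * f z)%C) by now apply Cmod_gt_0.
  apply Rmult_le_reg_r with (1 := Hpos). unfold Rdiv.
  rewrite Rmult_assoc, Rinv_l, Rmult_1_r, Rmult_1_l by lra.
  assert (Hid := moebius_energy w 1 (f z)).
  replace (1 - Cconj w * f z)%C with (1 + - Cconj w * f z)%C in Hid by ring.
  replace (w * 1 - f z)%C with (w + -1 * f z)%C in Hid by ring.
  rewrite Cmod_1 in Hid.
  set (x := Cmod (w + -1 * f z)%C) in *.
  set (y := Cmod (1 + - Cconj w * f z)%C) in *.
  assert (0 <= x) by apply Cmod_ge_0.
  assert (0 <= (1 - Cmod w ^ 2) * (1 ^ 2 - Cmod (f z) ^ 2)).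
  { apply Rmult_le_pos; generalize (Cmod_ge_0 w) (Cmod_ge_0 (f z)); nra. }
  apply Rnot_lt_le. intros Hn. nra. }
assert (Hd : expands_at om 0 d) by now apply Hexp.
assert (Hden : (1 + - Cconj w * w <> 0)%C) by (apply moebius_denominator; lra).
assert (Hd0 : d O = RtoC 0).
{ unfold d. simpl. fold w. field. auto. }
exists (quotient_at_0 om d), (tail d). repeat split.
- now apply quotient_at_0_smooth.
- now apply schwarz_quotient.
- now apply quotient_at_0_expands.
- intros k. rewrite <- (conv_fdiv (affine w (-1) a) (affine 1 (- Cconj w) a)) by auto.
  apply conv_ext; auto. intros [|j]; [symmetry; exact Hd0|reflexivity].
Qed.

(** Schur algorithm: the function g of the Schur step supplies the contraction
    of the previous size. *)
Lemma bounded_contraction (n : nat) (f : C -> C) (a : nat -> C) :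
  smooth_in_disc f -> bounded_by_1 f -> expands_at f 0 a -> contraction a n.
Proof.
assert (H0 : unit_disc 0) by (unfold unit_disc; rewrite Cmod_0; lra).
revert f a; induction n as [|n IH]; intros f a Hf Hb Ha.
- intros p. unfold energy, sum_f_R0. change (conv a p O) with (a O * p O)%C.
  rewrite Cmod_mult.
  assert (Cmod (a O) <= 1).
  { rewrite <- (expands_at_value f 0 a Ha). now apply Hb. }
  rewrite Rpow_mult_distr.
  assert (Cmod (a O) ^ 2 <= 1) by (generalize (Cmod_ge_0 (a O)); nra).
  generalize (pow2_ge_0 (Cmod (p O))). nra.
- apply contraction_scale_limit. intros l Hl.
  set (f' := fun z => (0 + RtoC l * f z)%C).
  set (a' := (fun k => RtoC l * a k)%C).
  assert (Hexp : forall z0 b, expands_at f z0 b ->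
            expands_at f' z0 (affine 0 l b)).
  { intros. now apply expands_at_affine. }
  assert (Ha' : expands_at f' 0 a').
  { apply expands_at_coef_ext with (2 := Hexp 0%C a Ha).
    intros [|k]; unfold a'; simpl; ring. }
  assert (Hmod : forall z, Cmod (RtoC l * z)%C = l * Cmod z).
  { intros z. rewrite Cmod_mult, Cmod_R, Rabs_pos_eq; lra. }
  assert (Hf' : smooth_in_disc f').
  { intros z0 Hz0. destruct (Hf z0 Hz0) as (b & Hfb). eauto. }
  assert (Hb' : bounded_by_1 f').
  { intros z Hz. unfold f'. rewrite Cplus_0_l, Hmod. specialize (Hb z Hz).
    generalize (Cmod_ge_0 (f z)). nra. }
  assert (Hw : Cmod (a' O) < 1).
  { unfold a'. rewrite Hmod, <- (expands_at_value f 0 a Ha).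
    specialize (Hb _ H0). generalize (Cmod_ge_0 (f 0)). nra. }
  destruct (schur_step f' a' Hf' Hb' Ha' Hw) as (g & c & Hg & Hgb & Hc & Hrel).
  apply (schur_step_contraction (a' O) a' c); auto.
  now apply IH with (f := g).
Qed.

(** * Convergence of the Taylor series in the disc *)

(** Divide by z, k times. *)
Lemma taylor_remainder (k : nat) (f : C -> C) (a : nat -> C) :
  smooth_in_disc f -> expands_at f 0 a ->
  exists g, smooth_in_disc g /\ forall z, f z = (psum k a z + z ^ k * g z)%C.
Proof.
revert f a; induction k as [|k IH]; intros f a Hf Ha.
- exists f. split; auto. intros z. simpl. ring.
- destruct (IH (quotient_at_0 f a) (tail a)) as (g & Hg & Hfg).
  + now apply quotient_at_0_smooth.
  + now apply quotient_at_0_expands.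
  + exists g. split; auto. intros z.
    rewrite (quotient_at_0_eq f a z Ha), Hfg. simpl. ring.
Qed.

Lemma psum_bound (n : nat) (a : nat -> C) (z : C) :
  Cmod z < 1 -> (forall k, Cmod (a k) <= 1) ->
  Cmod (psum n a z) <= / (1 - Cmod z).
Proof.
intros Hz. assert (Hp : 0 < / (1 - Cmod z)) by (apply Rinv_0_lt_compat; lra).
revert a; induction n as [|n IH]; intros a Ha; simpl.
- rewrite Cmod_0. lra.
- eapply Rle_trans; [apply Cmod_triangle|]. rewrite Cmod_mult.
  assert (H1 := IH (tail a) (fun k => Ha (S k))).
  assert (H2 := Ha O). assert (H3 := Cmod_ge_0 z).
  assert (H4 : (1 - Cmod z) * / (1 - Cmod z) = 1) by (field; lra). nra.
Qed.

(** The coefficients have modulus at most 1, so on |z| = s the partial sums are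
    at most 1 / (1 - s) and the remainder z^k g satisfies |g| <= B / s^k with B
    independent of k. The maximum principle extends the bound to |z| < s, where
    z^k g then tends to 0. *)
Lemma bounded_expansion (f : C -> C) (a : nat -> C) :
  smooth_in_disc f -> bounded_by_1 f -> expands_at f 0 a -> has_expansion f a.
Proof.
intros Hf Hb Ha z Hz. unfold unit_disc in Hz. rewrite is_pseries_psum.
assert (Hcoef : forall k, Cmod (a k) <= 1).
{ intros k. apply contraction_coef with k; auto. now apply bounded_contraction with f. }
set (s := (1 + Cmod z) / 2). assert (Hz0 := Cmod_ge_0 z).
assert (Hs : 0 < s < 1 /\ Cmod z < s) by (unfold s; lra).
destruct Hs as (Hs & Hzs).
set (B := 1 + / (1 - s)).
assert (HB : 0 < B).
{ unfold B. assert (0 < / (1 - s)) by (apply Rinv_0_lt_compat; lra). lra. }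
assert (Hrem : forall k, Cmod (psum k a z - f z)%C <= B * (Cmod z / s) ^ k).
{ intros k. destruct (taylor_remainder k f a Hf Ha) as (g & Hg & Hfg).
  assert (Hsk : 0 < s ^ k) by (apply pow_lt; lra).
  assert (Hgz : Cmod (g z) <= B / s ^ k).
  { apply maximum_principle with (s := s); auto; try lra.
    - left. now apply Rdiv_lt_0_compat.
    - intros x Hx. apply Rmult_le_reg_l with (s ^ k); auto.
      replace (s ^ k * (B / s ^ k)) with B by (field; lra).
      rewrite <- Hx at 1. rewrite <- Cmod_pow, <- Cmod_mult.
      replace (x ^ k * g x)%C with (f x + - psum k a x)%C by (rewrite Hfg; ring).
      eapply Rle_trans; [apply Cmod_triangle|]. rewrite Cmod_opp.
      assert (Cmod (f x) <= 1) by (apply Hb; unfold unit_disc; lra).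
      assert (Hps := psum_bound k a x ltac:(lra) Hcoef). rewrite Hx in Hps.
      unfold B. lra. }
  replace (psum k a z - f z)%C with (- (z ^ k * g z))%C by (rewrite Hfg; ring).
  rewrite Cmod_opp, Cmod_mult, Cmod_pow. unfold Rdiv at 1.
  rewrite Rpow_mult_distr, pow_inv.
  replace (B * (Cmod z ^ k * / s ^ k)) with (Cmod z ^ k * (B / s ^ k)) by (field; lra).
  apply Rmult_le_compat_l; auto. now apply pow_le. }
assert (Ht : Rabs (Cmod z / s) < 1).
{ assert (0 <= Cmod z / s) by (apply Rdiv_le_0_compat; lra).
  rewrite Rabs_pos_eq by auto. apply Rmult_lt_reg_r with s; [lra|].
  unfold Rdiv. rewrite Rmult_assoc, Rinv_l; lra. }
intros eps Heps.
destruct (pow_lt_1_zero (Cmod z / s) Ht (eps / B)) as (N & HN).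
{ now apply Rdiv_lt_0_compat. }
exists N. intros n Hn. apply Rle_lt_trans with (1 := Hrem (S n)).
specialize (HN (S n) ltac:(lia)). apply Rabs_def2 in HN.
replace eps with (B * (eps / B)) by (field; lra).
apply Rmult_lt_compat_l; lra.
Qed.

(** * Partial sums of majorant series *)

Definition partial_majorant (n : nat) (u : nat -> C) (r : R) : R :=
  sum_f_R0 (fun k => Cmod (u k) * r ^ k) n.

Lemma partial_majorant_S (n : nat) (u : nat -> C) (r : R) :
  partial_majorant (S n) u r = Cmod (u O) + r * partial_majorant n (tail u) r.
Proof.
unfold partial_majorant. rewrite decomp_sum by lia. simpl Nat.pred. rewrite scal_sum.
f_equal; [simpl; ring|]. apply sum_eq. intros k _. unfold tail. simpl. ring.
Qed.

Lemma partial_majorant_ge_0 (n : nat) (u : nat -> C) (r : R) :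
  0 <= r -> 0 <= partial_majorant n u r.
Proof.
intros Hr. apply cond_pos_sum. intros k.
apply Rmult_le_pos; [apply Cmod_ge_0|now apply pow_le].
Qed.

Lemma partial_majorant_le_S (n : nat) (u : nat -> C) (r : R) :
  0 <= r -> partial_majorant n u r <= partial_majorant (S n) u r.
Proof.
intros Hr. unfold partial_majorant. rewrite tech5.
generalize (Rmult_le_pos _ _ (Cmod_ge_0 (u (S n))) (pow_le r (S n) Hr)). lra.
Qed.

Lemma partial_majorant_ext (n : nat) (u v : nat -> C) (r : R) :
  (forall k, Cmod (u k) = Cmod (v k)) -> partial_majorant n u r = partial_majorant n v r.
Proof. intros H. apply sum_eq. intros k _. now rewrite H. Qed.

Lemma partial_majorant_scal (n : nat) (l : C) (u : nat -> C) (r : R) :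
  partial_majorant n (fun k => l * u k)%C r = Cmod l * partial_majorant n u r.
Proof.
unfold partial_majorant. rewrite scal_sum. apply sum_eq.
intros k _. rewrite Cmod_mult. ring.
Qed.

Lemma partial_majorant_plus (n : nat) (u v : nat -> C) (r : R) : 0 <= r ->
  partial_majorant n (fun k => u k + v k)%C r
  <= partial_majorant n u r + partial_majorant n v r.
Proof.
intros Hr. unfold partial_majorant. rewrite <- plus_sum. apply sum_Rle. intros k _.
rewrite <- Rmult_plus_distr_r. apply Rmult_le_compat_r; [now apply pow_le|].
apply Cmod_triangle.
Qed.

(** Coefficientwise triangle inequality in the Cauchy product. *)
Lemma partial_majorant_conv (n : nat) (u v : nat -> C) (r : R) : 0 <= r ->
  partial_majorant n (conv u v) r <= partial_majorant n u r * partial_majorant n v r.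
Proof.
intros Hr. revert u; induction n as [|n IH]; intros u.
- unfold partial_majorant. simpl. rewrite Cmod_mult. right; ring.
- rewrite partial_majorant_S.
  change (tail (conv u v)) with (fun k => u O * tail v k + conv (tail u) v k)%C.
  assert (H1 := partial_majorant_plus n (fun k => u O * tail v k)%C
                  (conv (tail u) v) r Hr).
  rewrite partial_majorant_scal in H1.
  assert (H2 := IH (tail u)). assert (H3 := partial_majorant_le_S n v r Hr).
  assert (H4 := partial_majorant_ge_0 n (tail u) r Hr).
  assert (H5 : partial_majorant n (tail u) r * partial_majorant n v r
               <= partial_majorant n (tail u) r * partial_majorant (S n) v r)
    by (apply Rmult_le_compat_l; auto).
  assert (H6 : r * partial_majorant n (fun k => u O * tail v k + conv (tail u) v k)%C r
    <= r * (Cmod (u O) * partial_majorant n (tail v) r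
            + partial_majorant n (tail u) r * partial_majorant (S n) v r))
    by (apply Rmult_le_compat_l; lra).
  rewrite (partial_majorant_S n u r). rewrite Rmult_plus_distr_r.
  rewrite (partial_majorant_S n v r) at 1. change (conv u v O) with (u O * v O)%C.
  rewrite Cmod_mult. lra.
Qed.

Lemma partial_majorant_const_bound (n : nat) (u : nat -> C) (m r : R) : 0 <= r ->
  (forall k, Cmod (u k) <= m) -> r < 1 -> (1 - r) * partial_majorant n u r <= m.
Proof.
intros Hr Hu Hr1. revert u Hu; induction n as [|n IH]; intros u Hu.
- unfold partial_majorant. simpl. generalize (Hu O) (Cmod_ge_0 (u O)). nra.
- rewrite partial_majorant_S. generalize (Hu O) (IH (tail u) (fun k => Hu (S k))). nra.
Qed.

(** Bohr's theorem: with b = |c_0| the sum is at most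
    b + (1 - b^2) r / (1 - r) <= b + (1 - b^2) / 2 <= 1. *)
Lemma bohr_third (n : nat) (c : nat -> C) (r : R) :
  (forall m, contraction c m) -> 0 <= r <= 1 / 3 -> partial_majorant n c r <= 1.
Proof.
intros Hc Hr.
assert (Hb : Cmod (c O) <= 1) by (apply contraction_coef with (2 := Hc O); lia).
assert (Hb0 := Cmod_ge_0 (c O)).
destruct n as [|n]; [unfold partial_majorant; simpl; lra|].
rewrite partial_majorant_S.
assert (H := partial_majorant_const_bound n (tail c) (1 - Cmod (c O) ^ 2) r ltac:(lra)
  (fun k => contraction_coef_gap c k (Hc (S k))) ltac:(lra)).
assert (H0 := partial_majorant_ge_0 n (tail c) r ltac:(lra)).
assert (r * partial_majorant n (tail c) r <= (1 - Cmod (c O) ^ 2) / 2) by nra.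
nra.
Qed.

(** Abel summation against the decreasing weights rho^k. *)
Lemma weighted_sum_nonneg (d : nat -> R) (rho : R) (n : nat) :
  0 <= rho <= 1 -> (forall m, 0 <= sum_f_R0 d m) ->
  rho ^ n * sum_f_R0 d n <= sum_f_R0 (fun k => rho ^ k * d k) n.
Proof.
intros Hrho Hd. induction n as [|n IH]; [simpl; lra|].
rewrite !tech5.
assert (H := Hd n). assert (0 <= rho ^ n) by (apply pow_le; lra).
simpl pow. assert (rho * rho ^ n <= rho ^ n) by nra. nra.
Qed.

(** The energy inequality holds for every size, so it may be averaged with
    decreasing weights. *)
Lemma contraction_weighted (c e : nat -> C) (rho : R) (n : nat) :
  (forall m, contraction c m) -> 0 <= rho <= 1 ->
  sum_f_R0 (fun k => Cmod (conv c e k) ^ 2 * rho ^ k) n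
  <= sum_f_R0 (fun k => Cmod (e k) ^ 2 * rho ^ k) n.
Proof.
intros Hc Hrho.
set (d := fun k => Cmod (e k) ^ 2 - Cmod (conv c e k) ^ 2).
assert (Hd : forall m, 0 <= sum_f_R0 d m).
{ intros m. unfold d. rewrite minus_sum. generalize (Hc m e). unfold energy. lra. }
assert (H := weighted_sum_nonneg d rho n Hrho Hd).
assert (H0 : 0 <= rho ^ n * sum_f_R0 d n)
  by (apply Rmult_le_pos; [apply pow_le; lra|auto]).
assert (E : sum_f_R0 (fun k => rho ^ k * d k) n
  = sum_f_R0 (fun k => Cmod (e k) ^ 2 * rho ^ k) n
    - sum_f_R0 (fun k => Cmod (conv c e k) ^ 2 * rho ^ k) n).
{ rewrite <- minus_sum. apply sum_eq. intros k _. unfold d. ring. }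
lra.
Qed.

Lemma geom_partial (q : R) (n : nat) : 0 <= q ->
  (1 - q) * sum_f_R0 (fun k => q ^ k) n <= 1.
Proof.
intros Hq. induction n as [|n IH]; [simpl; lra|]. 
destruct (Req_dec q 1) as [->|Hne]; [lra|].
rewrite tech3 by auto. replace ((1 - q) * ((1 - q ^ S (S n)) / (1 - q)))
  with (1 - q ^ S (S n)) by (field; lra).
generalize (pow_le q (S (S n)) Hq). lra.
Qed.

(** Write b = |w| and S for the sum of |a_(k+1)| r^k. The relation between a
    and c says that a_(k+1) is minus the k-th coefficient of the product of c
    with e = 1 - conj w f, whose coefficients have modulus
    1 - b^2, b |a_1|, b |a_2|, and so on. For r <= 1/3, [bohr_third] gives
    S <= (1 - b^2) + b r S. For r <= b, the weighted energy inequality with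
    rho = r / b bounds the sum V of |a_(k+1)|^2 rho^k by
    (1 - b^2)^2 / (1 - b r), and since r^2 = rho (b r), Cauchy-Schwarz against
    the geometric series of ratio b r gives the same bound for S. With this rho
    Cauchy-Schwarz is an equality at the disc automorphism, and rho <= 1 is the
    condition r <= b. *)
Lemma majorant_tail_bound (a c : nat -> C) (r : R) (n : nat) :
  let w := a O in
  Cmod w < 1 -> (forall m, contraction c m) ->
  (forall k, conv (shift c) (affine 1 (- Cconj w) a) k = affine w (-1) a k) ->
  0 <= r <= Rmax (Cmod w) (1 / 3) ->
  (1 - Cmod w * r) * partial_majorant n (tail a) r <= 1 - Cmod w ^ 2.
Proof.
intros w Hw Hc Hrel Hr. assert (Hw0 := Cmod_ge_0 w).
set (e := affine 1 (- Cconj w) a) in *.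
assert (Hce : forall k, Cmod (conv c e k) = Cmod (tail a k)).
{ intros k. assert (H := Hrel (S k)). rewrite conv_shift_l in H. simpl in H.
  rewrite H, Cmod_mult. replace (Cmod (-1)%C) with 1; [unfold tail; ring|].
  rewrite Cmod_R, Rabs_left; lra. }
assert (He0 : Cmod (e O) = 1 - Cmod w ^ 2).
{ unfold e. simpl affine. fold w.
  replace (1 + - Cconj w * w)%C with (RtoC (1 - Cmod w ^ 2)).
  - rewrite Cmod_R, Rabs_pos_eq; nra.
  - rewrite RtoC_minus, <- Cconj_mult_self. ring. }
assert (He : forall k, Cmod (e (S k)) = Cmod w * Cmod (tail a k)).
{ intros k. unfold e. simpl. rewrite Cmod_mult, Cmod_opp, Cmod_conj. reflexivity. }
set (m := 1 - Cmod w ^ 2) in *. assert (Hm : 0 < m) by (unfold m; nra).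
destruct (Rle_lt_dec r (1 / 3)) as [H3|H3].
- assert (H1 := partial_majorant_conv n c e r ltac:(lra)).
  rewrite (partial_majorant_ext n (conv c e) (tail a) r Hce) in H1.
  assert (H2 := bohr_third n c r Hc ltac:(lra)).
  assert (H4 : partial_majorant n e r <= m + Cmod w * r * partial_majorant n (tail a) r).
  { assert (Hp := fun n => partial_majorant_ge_0 n (tail a) r (proj1 Hr)).
    assert (Hwr : 0 <= Cmod w * r) by nra.
    destruct n as [|n].
    - unfold partial_majorant at 1, sum_f_R0. rewrite He0. specialize (Hp O). nra.
    - rewrite partial_majorant_S, He0.
      replace (partial_majorant n (tail e) r)
        with (Cmod w * partial_majorant n (tail a) r).
      + assert (H5 := partial_majorant_le_S n (tail a) r (proj1 Hr)). nra.
      + unfold partial_majorant. rewrite scal_sum. apply sum_eq. intros k _.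
        change (tail e k) with (e (S k)). rewrite He. ring. }
  assert (H5 := partial_majorant_ge_0 n e r (proj1 Hr)). nra.
- assert (Hra : r <= Cmod w).
  { destruct Hr as (_ & Hr). revert Hr. apply Rmax_case; lra. }
  assert (Hwp : 0 < Cmod w) by lra.
  set (al := Cmod w) in *. set (rho := r / al).
  assert (Hrho : 0 <= rho <= 1).
  { split; [apply Rdiv_le_0_compat; lra|].
    apply Rmult_le_reg_r with al; auto. unfold rho, Rdiv.
    rewrite Rmult_assoc, Rinv_l; lra. }
  assert (Hrr : al * rho = r) by (unfold rho; field; lra).
  set (V := sum_f_R0 (fun k => Cmod (tail a k) ^ 2 * rho ^ k) n).
  set (G := sum_f_R0 (fun k => (al * r) ^ k) n).
  assert (Hq : 0 <= al * r < 1) by nra.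
  assert (HV : V * (1 - al * r) <= m ^ 2).
  { assert (H1 := contraction_weighted c e rho n Hc Hrho).
    rewrite (sum_eq (fun k => Cmod (conv c e k) ^ 2 * rho ^ k)
      (fun k => Cmod (tail a k) ^ 2 * rho ^ k)) in H1 by (intros; now rewrite Hce).
    fold V in H1.
    assert (H2 : sum_f_R0 (fun k => Cmod (e k) ^ 2 * rho ^ k) n
                 <= m ^ 2 + al * r * V).
    { assert (Hpos : forall k, 0 <= Cmod (tail a k) ^ 2 * rho ^ k).
      { intros k. apply Rmult_le_pos; [apply pow2_ge_0|apply pow_le; lra]. }
      unfold V. clear H1 V. destruct n as [|n].
      - unfold sum_f_R0. rewrite He0. specialize (Hpos O). simpl in *. nra.
      - rewrite decomp_sum by lia. rewrite He0. simpl Nat.pred.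
        rewrite (sum_eq (fun i => Cmod (e (S i)) ^ 2 * rho ^ S i)
          (fun k => Cmod (tail a k) ^ 2 * rho ^ k * (al * r))).
        + rewrite <- scal_sum, tech5.
          assert (0 <= al * r * (Cmod (tail a (S n)) ^ 2 * rho ^ S n))
            by (apply Rmult_le_pos; [lra|auto]).
          rewrite Rmult_plus_distr_l. simpl (rho ^ 0). lra.
        + intros k _. rewrite He. rewrite <- Hrr at 1. simpl. ring. }
    nra. }
  assert (HG : (1 - al * r) * G <= 1) by (apply geom_partial; lra).
  assert (HS : 2 * m * partial_majorant n (tail a) r <= V + m ^ 2 * G).
  { unfold V, G, partial_majorant. rewrite !scal_sum, <- plus_sum. apply sum_Rle.
    intros k _. set (x := Cmod (tail a k)).
    assert (Hx : 0 <= x) by apply Cmod_ge_0.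
    assert (HP : 0 <= rho ^ k) by (apply pow_le; lra).
    assert (HQ : 0 <= (al * r) ^ k) by (apply pow_le; lra).
    assert (HR : 0 <= r ^ k) by (apply pow_le; lra).
    assert (HPQ : rho ^ k * (al * r) ^ k = r ^ k * r ^ k).
    { rewrite <- !Rpow_mult_distr. f_equal. rewrite <- Hrr at 2. ring. }
    set (P := rho ^ k) in *. set (Q := (al * r) ^ k) in *. set (R0 := r ^ k) in *.
    apply Rnot_lt_le. intros Hlt.
    assert (HA : 0 <= x ^ 2 * P) by (apply Rmult_le_pos; [apply pow2_ge_0|auto]).
    assert (HB : 0 <= Q * m ^ 2) by (apply Rmult_le_pos; [auto|apply pow2_ge_0]).
    assert (HAB : (x ^ 2 * P) * (Q * m ^ 2) = (x * R0 * m) ^ 2).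
    { transitivity (x ^ 2 * m ^ 2 * (P * Q)); [ring|]. rewrite HPQ. ring. }
    set (A := x ^ 2 * P) in *. set (B := Q * m ^ 2) in *.
    generalize (pow2_ge_0 (A - B)). nra. }
  apply Rmult_le_reg_l with (2 * m); [lra|]. nra.
Qed.

(** * The disc automorphism and the comparison *)

Definition automorphism_coef (w : C) (k : nat) : C :=
  match k with O => w | S j => ((Cconj w * w - 1) * Cconj w ^ j)%C end.

(** The remainder after n + 1 terms is an explicit multiple of (conj w z)^n. *)
Lemma automorphism_expansion (w : C) :
  Cmod w < 1 -> has_expansion (disc_automorphism w) (automorphism_coef w).
Proof.
intros Hw z Hz. unfold unit_disc in Hz. rewrite is_pseries_psum.
assert (Hne : (1 - Cconj w * z <> 0)%C).
{ replace (1 - Cconj w * z)%C with (1 + - Cconj w * z)%C by ring.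
  apply moebius_denominator; lra. }
assert (Hrem : forall n, (psum (S n) (automorphism_coef w) z - disc_automorphism w z
  = (1 - Cconj w * w) * z / (1 - Cconj w * z) * (Cconj w * z) ^ n)%C).
{ unfold disc_automorphism. induction n as [|n IH].
  - simpl. field. auto.
  - rewrite psum_last.
    transitivity ((psum (S n) (automorphism_coef w) z - (w - z) / (1 - Cconj w * z))
      + automorphism_coef w (S n) * z ^ S n)%C; [ring|].
    rewrite IH, !Cpow_mult_l. simpl. field. auto. }
set (B := Cmod ((1 - Cconj w * w) * z / (1 - Cconj w * z))%C).
assert (HB : 0 <= B) by apply Cmod_ge_0.
intros eps Heps.
assert (Hq : Rabs (Cmod (Cconj w * z)%C) < 1).
{ rewrite Rabs_pos_eq, Cmod_mult, Cmod_conj by apply Cmod_ge_0.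
  generalize (Cmod_ge_0 w) (Cmod_ge_0 z). nra. }
destruct (pow_lt_1_zero _ Hq (eps / (B + 1))) as (N & HN).
{ apply Rdiv_lt_0_compat; lra. }
exists N. intros n Hn. rewrite Hrem, Cmod_mult, Cmod_pow. fold B.
specialize (HN n Hn). apply Rabs_def2 in HN.
assert (H0 : 0 <= Cmod (Cconj w * z)%C ^ n) by apply pow_le, Cmod_ge_0.
assert (He : eps / (B + 1) * (B + 1) = eps) by (field; lra).
nra.
Qed.

Lemma coeffs_spec (f : C -> C) :
  (exists a, has_expansion f a) -> has_expansion f (coeffs f).
Proof. intros H. unfold coeffs. now apply epsilon_spec. Qed.

(** Uniqueness of expansions identifies [coeffs] with the explicit
    coefficients; the sum is then geometric. *)
Lemma majorant_automorphism (w : C) (r : R) : Cmod w < 1 -> 0 <= r < 1 ->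
  majorant (disc_automorphism w) r
  = Cmod w + r * (1 - Cmod w ^ 2) / (1 - Cmod w * r).
Proof.
intros Hw Hr. assert (Hw0 := Cmod_ge_0 w).
assert (Hexp := automorphism_expansion w Hw).
assert (Hcoef : forall k, coeffs (disc_automorphism w) k = automorphism_coef w k).
{ intros k. apply expands_at_unique with (disc_automorphism w);
    apply expansion_expands_at_0; auto. apply coeffs_spec. eauto. }
unfold majorant, PSeries.
rewrite (Series_ext _ (fun k => Cmod (automorphism_coef w k) * r ^ k))
  by (intros; now rewrite Hcoef).
assert (Hq : Rabs (Cmod w * r) < 1) by (rewrite Rabs_pos_eq; nra).
assert (Hk : forall k, Cmod (automorphism_coef w (S k)) * r ^ S k
  = r * (1 - Cmod w ^ 2) * (Cmod w * r) ^ k).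
{ intros k. simpl automorphism_coef. rewrite Cmod_mult, Cmod_pow, Cmod_conj.
  replace (Cconj w * w - 1)%C with (- RtoC (1 - Cmod w ^ 2))%C
    by (rewrite RtoC_minus, <- Cconj_mult_self; ring).
  rewrite Cmod_opp, Cmod_R, Rabs_pos_eq by nra.
  rewrite Rpow_mult_distr. simpl. ring. }
rewrite Series_incr_1.
- rewrite (Series_ext _ _ Hk), Series_scal_l, Series_geom by auto.
  simpl. unfold Rdiv. ring.
- apply ex_series_incr_1.
  apply ex_series_ext with (fun k => r * (1 - Cmod w ^ 2) * (Cmod w * r) ^ k).
  + intros k. now rewrite Hk.
  + apply (ex_series_scal (V := R_NormedModule) (r * (1 - Cmod w ^ 2))
             (fun k => (Cmod w * r) ^ k)).
    now apply ex_series_geom.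
Qed.

Lemma Series_le_bound (u : nat -> R) (M : R) :
  (forall k, 0 <= u k) -> (forall n, sum_f_R0 u n <= M) -> Series u <= M.
Proof.
intros Hu HM.
assert (Hfin : ex_finite_lim_seq (sum_n u)).
{ apply ex_finite_lim_seq_incr with M.
  - intros n. rewrite !sum_n_Reals, tech5. generalize (Hu (S n)). lra.
  - intros n. rewrite sum_n_Reals. apply HM. }
destruct Hfin as (l & Hl). unfold Series. rewrite (is_lim_seq_unique _ _ Hl). simpl.
apply (is_lim_seq_le (sum_n u) (fun _ => M) l M); auto.
- intros n. rewrite sum_n_Reals. apply HM.
- apply is_lim_seq_const.
Qed.

Theorem mainTheorem2 (f : C -> C) (hf : schur_class f)
  (hf0 : Cmod (f (RtoC 0)) < 1)
  (r : R) (hr0 : 0 <= r) (hr : r <= Rmax (Cmod (f (RtoC 0))) (1 / 3)) :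
  majorant f r <= majorant (disc_automorphism (f (RtoC 0))) r.
Proof.
destruct hf as (Han & Hb). assert (Hf := analytic_smooth f Han).
assert (H0 : unit_disc 0) by (unfold unit_disc; rewrite Cmod_0; lra).
assert (Hexp : has_expansion f (coeffs f)).
{ apply coeffs_spec. destruct (Hf 0 H0) as (b & Hfb).
  exists b. now apply bounded_expansion. }
set (a := coeffs f) in *.
assert (Ha := expansion_expands_at_0 f a Hexp).
assert (Hw : f (RtoC 0) = a O) by now apply expands_at_value.
rewrite Hw in *. assert (Hw0 := Cmod_ge_0 (a O)).
assert (Hr1 : r < 1).
{ apply Rle_lt_trans with (1 := hr). apply Rmax_lub_lt; lra. }
destruct (schur_step f a Hf Hb Ha hf0) as (g & c & Hg & Hgb & Hc & Hrel).
rewrite majorant_automorphism by lra.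
assert (Hden : 0 < 1 - Cmod (a O) * r) by nra.
assert (Htail : forall n, partial_majorant n (tail a) r
   <= (1 - Cmod (a O) ^ 2) / (1 - Cmod (a O) * r)).
{ intros n. apply Rmult_le_reg_l with (1 := Hden).
  replace ((1 - Cmod (a O) * r) * ((1 - Cmod (a O) ^ 2) / (1 - Cmod (a O) * r)))
    with (1 - Cmod (a O) ^ 2) by (field; lra).
  apply majorant_tail_bound with c; auto.
  intros m. now apply bounded_contraction with g. }
unfold majorant, PSeries. fold a. apply Series_le_bound.
- intros k. apply Rmult_le_pos; [apply Cmod_ge_0|now apply pow_le].
- intros n. fold (partial_majorant n a r).
  apply Rle_trans with (1 := partial_majorant_le_S n a r hr0).
  rewrite partial_majorant_S. unfold Rdiv. rewrite Rmult_assoc.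
  apply Rplus_le_compat_l, Rmult_le_compat_l; auto.
Qed.
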